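(* Let $\alpha=\{t_j\}_{j\ge 1}\subset[0,1]$ be a strictly decreasing sequence with $t_1=1$ and $t_j\to 0$ as $j\to\infty$. Let $G:[0,1]\to[0,1]$ be the Gauss map, let $L_\alpha:[0,1]\to[0,1]$ be the $\alpha$-Lüroth map, and let $?_\alpha:[0,1]\to[0,1]$ be the function associated with $\alpha$ (all as defined in the context). Then $?_\alpha$ is an increasing homeomorphism of $[0,1]$ onto itself, it is singular (its derivative exists and equals $0$ at Lebesgue almost every $x\in[0,1]$), and $$L_\alpha\circ ?_\alpha=?_\alpha\circ G\quad\text{on }[0,1].$$ Moreover, if $t_j\in\mathbb{Q}$ for every $j\ge 1$, then $?_\alpha(x)\in\mathbb{Q}$ for every quadratic surd $x\in[0,1]$.
   Context: For $x\in(0,1]$, the continued fraction expansion of $x$ is the sequence $[a_1,a_2,\ldots]$ of positive integers with $$x=\cfrac{1}{a_1+\cfrac{1}{a_2+\cdots}}.$$ It is infinite and unique if $x$ is irrational. If $x$ is rational it is finite, and it is unique up to the identity $[a_1,\ldots,a_n]=[a_1,\ldots,a_n-1,1]$ (for $a_n\ge 2$). The function $?_\alpha$ is defined by $?_\alpha(0):=0$ and, for $x\in(0,1]$ with continued fraction expansion $[a_1,a_2,\ldots]$, $$?_\alpha(x):=t_{a_1}+\sum_{n\ge 2}(-1)^{n+1}\Bigl(\prod_{j=1}^{n-1}(t_{a_j}-t_{a_j+1})\Bigr)\,t_{a_n},$$ the sum being finite when $x$ is rational (either finite expansion may be used, with the same value). Equivalently, $?_\alpha(x)$ is the number whose $\alpha$-Lüroth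 expansion is the continued fraction expansion of $x$. The Gauss map is $G(x)=\frac1x-\lfloor\frac1x\rfloor$ for $x\in(0,1]$ and $G(0)=0$. The $\alpha$-Lüroth map is $L_\alpha(0)=0$ and $$L_\alpha(x)=\frac{t_j-x}{t_j-t_{j+1}}\quad\text{if }x\in(t_{j+1},t_j],\ j\ge 1.$$ A quadratic surd is a real root of a quadratic polynomial with integer coefficients. *)

(* Defs.v *)
From HB Require Import structures.
From mathcomp Require Import all_boot all_order all_algebra.
From mathcomp Require Import all_classical all_reals all_analysis.
From mathcomp Require Import ring.

Set Implicit Arguments.
Unset Strict Implicit.
Unset Printing Implicit Defensive.

Import Order.TTheory GRing.Theory Num.Theory.
Import numFieldNormedType.Exports.

Local Open Scope classical_set_scope.
Local Open Scope ring_scope.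

(* Digit strings are indexed from 0, so digit n here is a_{n+1}. *)
Inductive cf_digits : Type :=
| Finite of seq nat
| Infinite of nat -> nat.

(* [a_1, ..., a_n], with the convention that the empty string has value 0. *)
Definition cf_value (R : realType) (s : seq nat) : R :=
  foldr (fun a (y : R) => (a%:R + y)^-1) 0 s.

Definition cf_expansion (R : realType) (a : cf_digits) (x : R) : Prop :=
  match a with
  | Finite s => [/\ s != [::], all (leq 1) s & cf_value R s = x]
  | Infinite d =>
      (forall n, (1 <= d n)%N) /\ cf_value R (mkseq d n) @[n --> \oo] --> x
  end.

(* With n counted from 0, the sign (-1)^(n+1) of the n-th term becomes (-1)^n,
   and the term n = 0 is t_{a_1}. *)
Definition luroth_term (R : realType) (t : nat -> R) (d : nat -> nat) (n : nat)
    : R :=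
  (-1) ^+ n * (\prod_(j < n) (t (d j) - t (d j).+1)) * t (d n).

Definition luroth_sum (R : realType) (t : nat -> R) (a : cf_digits) : R :=
  match a with
  | Finite s => \sum_(n < size s) luroth_term t (nth 0%N s) n
  | Infinite d => limn (series (luroth_term t d))
  end.

(* The two finite expansions of a rational have the same value, both as
   continued fractions and as Lüroth expansions; hence the choice made
   in [question_mark] is immaterial. *)
Lemma cf_value_split (R : realType) (s : seq nat) (a : nat) :
  cf_value R (rcons (rcons s a.+1) 1) = cf_value R (rcons s a.+2).
Proof.
rewrite /cf_value !foldr_rcons; congr foldr.
by rewrite !addr0 invr1 -[in RHS]natr1.
Qed.

Lemma luroth_sum_split (R : realType) (t : nat -> R) (s : seq nat) (a : nat) :
  t 1%N = 1 ->
  luroth_sum t (Finite (rcons (rcons s a.+1) 1)) =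
  luroth_sum t (Finite (rcons s a.+2)).
Proof.
move=> t1.
have agree (d d' : nat -> nat) n : (forall i, (i <= n)%N -> d i = d' i) ->
    luroth_term t d n = luroth_term t d' n.
  move=> dd'; rewrite /luroth_term (dd' n (leqnn n)); congr (_ * _ * _).
  by apply: eq_bigr => j _; rewrite dd' // ltnW.
rewrite /luroth_sum !size_rcons !big_ord_recr /= -addrA; congr (_ + _).
  apply: eq_bigr => n _; apply: agree => i le_in.
  have lt_is : (i < size s)%N := leq_ltn_trans le_in (ltn_ord n).
  by rewrite !nth_rcons size_rcons lt_is ltnS (ltnW lt_is).
rewrite /luroth_term big_ord_recr /=.
have prodE s' (c : nat) : \prod_(j < size s)
      (t (nth 0%N (rcons (rcons s c) s') j) -
       t (nth 0%N (rcons (rcons s c) s') j).+1) =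
    \prod_(j < size s) (t (nth 0%N s j) - t (nth 0%N s j).+1).
  apply: eq_bigr => j _.
  by rewrite !nth_rcons size_rcons ltn_ord ltnS (ltnW (ltn_ord j)).
have prodE1 : \prod_(j < size s)
      (t (nth 0%N (rcons s a.+2) j) - t (nth 0%N (rcons s a.+2) j).+1) =
    \prod_(j < size s) (t (nth 0%N s j) - t (nth 0%N s j).+1).
  by apply: eq_bigr => j _; rewrite !nth_rcons ltn_ord.
rewrite prodE prodE1 !nth_rcons !size_rcons !ltnSn !ltnn !eqxx t1 exprS; ring.
Qed.

(* [xget] selects the common value of the sums over all expansions of x.  Only
   the values on [0, 1] are meaningful. *)
Definition question_mark (R : realType) (t : nat -> R) (x : R) : R :=
  if x == 0 then 0
  else xget 0 [set luroth_sum t a | a in [set a | cf_expansion a x]].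

Definition gauss_map (R : realType) (x : R) : R :=
  if x == 0 then 0 else x^-1 - (Num.floor x^-1)%:~R.

(* [xget] picks the unique j >= 1 with x in (t_{j+1}, t_j]. *)
Definition luroth_map (R : realType) (t : nat -> R) (x : R) : R :=
  if x == 0 then 0
  else let j := xget 0%N [set j : nat | (1 <= j)%N /\ t j.+1 < x <= t j] in
       (t j - x) / (t j - t j.+1).

Definition homeomorphism_on (T U : topologicalType) (A : set T) (B : set U)
    (f : T -> U) : Prop :=
  [/\ set_bij A B f, {within A, continuous f} &
      exists g : U -> T,
        [/\ {within B, continuous g}, {in A, cancel f g} &
            {in B, cancel g f}]].

Definition quadratic_surd (R : realType) (x : R) : Prop :=
  exists p : {poly int}, size p = 3%N /\ root (map_poly intr p) x.

(* Main.v *)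
(* Under x = 1/(a + y) the function Q = ?_alpha satisfies
   Q(x) = t_a - (t_a - t_{a+1}) Q(y).  This conjugates the continued fraction
   system with the alpha-Lueroth system; since both are contracting, Q is
   increasing with dense image, hence a homeomorphism.  A quadratic surd has an
   eventually periodic Gauss orbit (Lagrange), so its image is, up to affine
   maps with rational coefficients, the fixed point of a rational affine
   contraction.

   For singularity, compare on each cylinder the Lebesgue measure l with the
   measure m of increments of Q.  Passing to the children of a cylinder, m is
   split in the fixed proportions p_a = t_a - t_{a+1}, while l is split in the
   proportions (1 + r) / ((a + r)(a + 1 + r)), where r depends on the previous
   digits and takes values too far apart after a digit 1 and after a digit 3
   for both to match p.  Hence the sum of sqrt(l m) over the cylinders
   decreases geometrically.  By Vitali's lemma, the part in a given cylinder of
   the set where the upper derivative of Q is at least a fixed positive number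
   has outer measure at most a constant times min(l, m) <= sqrt(l m), so this
   set is null. *)
Require Import Defs.
From HB Require Import structures.
From mathcomp Require Import all_boot all_order all_algebra.
From mathcomp Require Import all_classical all_reals all_analysis.
From mathcomp Require Import ring lra zify.

Set Implicit Arguments.
Unset Strict Implicit.
Unset Printing Implicit Defensive.

Import Order.TTheory GRing.Theory Num.Theory.
Import numFieldNormedType.Exports.

Local Open Scope classical_set_scope.
Local Open Scope ring_scope.

(** * Continued fraction expansions and the Gauss map *)

Section ContinuedFractions.
Context {R : realType}.
Implicit Types (x y z : R) (a d : nat) (s : seq nat) (e : cf_digits).

Definition cf_cons d e : cf_digits :=
  match e with
  | Defs.Finite s => Defs.Finite (d :: s)
  | Infinite f => Infinite (fun n => if n is m.+1 then f m else d)
  end.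

(* Unlike [cf_expansion], allows the empty string as an expansion of 0. *)
Definition cf_expansion0 e x : Prop :=
  match e with
  | Defs.Finite s => all (leq 1) s /\ cf_value R s = x
  | Infinite _ => cf_expansion e x
  end.

Lemma cf_expansionW e x : cf_expansion e x -> cf_expansion0 e x.
Proof. by case: e => [s []|]. Qed.

Lemma cf_expansion0_neq0 e x : x != 0 -> cf_expansion0 e x -> cf_expansion e x.
Proof.
move=> x0; case: e => [s [s1 sx]|//]; split=> //.
by apply: contra_neq x0 => s0; rewrite -sx s0.
Qed.

Lemma mkseqSl (T : Type) (f : nat -> T) n :
  mkseq f n.+1 = f 0%N :: mkseq (f \o succn) n.
Proof. by rewrite /mkseq /= -[1%N]addn0 iotaDl -map_comp. Qed.

Lemma cf_value_bounds s : all (leq 1) s -> 0 <= cf_value R s <= 1.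
Proof.
elim: s => [|a s IH] /=; first by rewrite lexx ler01.
move=> /andP[a1 /IH/andP[s0 s1]].
have a1' : 1 <= a%:R :> R by rewrite ler1n.
by rewrite invr_ge0 invf_le1; lra.
Qed.

Lemma all_mkseq (f : nat -> nat) n :
  (forall n, (1 <= f n)%N) -> all (leq 1) (mkseq f n).
Proof. by move=> f1; apply/allP => i /mapP[j _ ->]. Qed.

Lemma cf_expansion0_bounds e x : cf_expansion0 e x -> 0 <= x <= 1.
Proof.
case: e => [s [s1 <-]|f [f1 fx]]; first exact: cf_value_bounds.
have b n := cf_value_bounds (all_mkseq n f1).
have cf : cvgn (fun n => cf_value R (mkseq f n)) by apply/cvg_ex; exists x.
rewrite -(cvg_lim _ fx)//; apply/andP; split.
- by apply: limr_ge => //; near=> n; have /andP[] := b n.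
- by apply: limr_le => //; near=> n; have /andP[] := b n.
Unshelve. all: by end_near. Qed.

Lemma cf_expansion0_cons d e z : (1 <= d)%N -> cf_expansion0 e z ->
  cf_expansion0 (cf_cons d e) (d%:R + z)^-1.
Proof.
move=> d1; case: e => [s [s1 <-]|f]; first by rewrite /= d1.
move=> fz; have /andP[z0 z1] := cf_expansion0_bounds fz.
case: fz => f1 fz; split; first by case.
rewrite -cvg_shiftS.
have -> : (fun n => cf_value R (mkseq (fun n => if n is m.+1 then f m else d) n.+1))
    = (fun n => (d%:R + cf_value R (mkseq f n))^-1).
  by apply/funext => n; rewrite mkseqSl.
apply: cvgV; first by rewrite lt0r_neq0// ltr_wpDr// ltr0n.
by apply: cvgD => //; apply: cvg_cst.
Qed.

(** For an infinite string with first digit d, the tail value is taken to be [x^-1] minus d.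
    Inversion is continuous at x because every nonempty truncation is at least 1/(d + 1). *)
Lemma cf_expansion0_decons e x : cf_expansion0 e x ->
  (e = Defs.Finite [::] /\ x = 0) \/
  exists d r z, [/\ e = cf_cons d r, (1 <= d)%N, cf_expansion0 r z &
                   x = (d%:R + z)^-1].
Proof.
case: e => [[|d s] /= [s1 sx]|f]; first by left.
  by right; exists d, (Defs.Finite s), (cf_value R s); case/andP: s1.
move=> [f1 fx]; right; exists (f 0%N), (Infinite (f \o succn)), (x^-1 - (f 0%N)%:R).
have d0 : 0 < (f 0%N)%:R :> R by rewrite ltr0n.
have fx' : cf_value R (mkseq f n.+1) @[n --> \oo] --> x.
  by move: fx; rewrite -cvg_shiftS.
have x0 : x != 0.
  apply/lt0r_neq0/(@lt_le_trans _ _ ((f 0%N)%:R + 1)^-1); first by rewrite invr_gt0; lra.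
  rewrite -(cvg_lim _ fx')//; apply: limr_ge; first by apply/cvg_ex; exists x.
  near=> n; rewrite mkseqSl -[leRHS]/((_ + cf_value R _)^-1).
  have /andP[v0 v1] := cf_value_bounds (all_mkseq n (fun k => f1 k.+1)).
  by rewrite lef_pV2 ?posrE ?lerD2l ?ltr_wpDr// ltr_wpDr.
split=> //; last by rewrite addrC subrK invrK.
- by congr Infinite; apply/funext; case.
- split; first by move=> n; exact: f1.
  have -> : (fun n => cf_value R (mkseq (f \o succn) n)) =
      (fun n => (cf_value R (mkseq f n.+1))^-1 - (f 0%N)%:R).
    by apply/funext => n; rewrite mkseqSl /= invrK addrAC subrr add0r.
  exact: cvgB (cvgV x0 fx') (cvg_cst ((f 0%N)%:R : R)).
Unshelve. all: by end_near. Qed.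

(** One inversion need not contract near 0 when its digit is 1, so two are composed: this is a
    Möbius map of determinant 1 whose denominators are at least 2. *)
Lemma cf_step_contraction a d y z : (1 <= a)%N -> (1 <= d)%N ->
  0 <= y -> 0 <= z ->
  `|(a%:R + (d%:R + y)^-1)^-1 - (a%:R + (d%:R + z)^-1)^-1| <= `|y - z| / 4.
Proof.
rewrite -!(ler1n R); set A := a%:R; set D := d%:R => a1 d1 y0 z0.
have hy : 2 <= A * (D + y) + 1 by nra.
have hz : 2 <= A * (D + z) + 1 by nra.
have -> : (A + (D + y)^-1)^-1 - (A + (D + z)^-1)^-1 =
    (y - z) * ((A * (D + y) + 1) * (A * (D + z) + 1))^-1.
  have ? : 0 < A * (D + y) by apply: mulr_gt0; lra.
  have ? : 0 < A * (D + z) by apply: mulr_gt0; lra.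
  by field; rewrite !lt0r_neq0//; lra.
rewrite normrM ler_wpM2l// ger0_norm ?invr_ge0; last by nra.
by rewrite lef_pV2 ?posrE; nra.
Qed.

(** On (0, 1] the floor is positive, so the absolute value only changes its type. *)
Definition gauss_digit x : nat := `|Num.floor x^-1|%N.

Lemma gauss_mapP x : 0 < x <= 1 ->
  [/\ x^-1 = (gauss_digit x)%:R + gauss_map x, (1 <= gauss_digit x)%N &
      0 <= gauss_map x < 1].
Proof.
move=> /andP[x0 x1].
have fl1 : 1 <= Num.floor x^-1.
  by rewrite floor_ge_int mulr1z invf_ge1.
have dE : (gauss_digit x)%:R = (Num.floor x^-1)%:~R :> R.
  by rewrite /gauss_digit -[in RHS](gez0_abs (le_trans _ fl1)).
have gE : gauss_map x = x^-1 - (Num.floor x^-1)%:~R by rewrite /gauss_map gt_eqF.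
split.
- by rewrite dE gE addrC subrK.
- by rewrite -(ler1n R) dE ler1z.
- by rewrite gE subr_ge0 floor_le ltrBlDl -[X in _ + X]/(1%:~R) -intrD floorD1_gt.
Qed.

Lemma gauss_map0 : gauss_map (0 : R) = 0.
Proof. by rewrite /gauss_map eqxx. Qed.

Lemma gauss_map_bounds x : 0 <= x <= 1 -> 0 <= gauss_map x < 1.
Proof.
move=> /andP[]; rewrite le_eqVlt => /predU1P[<-|x0 x1].
  by rewrite gauss_map0 lexx ltr01.
by have [] := gauss_mapP (introT andP (conj x0 x1)).
Qed.

Lemma gauss_digit_gt0 x : 0 < x <= 1 -> (1 <= gauss_digit x)%N.
Proof. by case/gauss_mapP. Qed.

Lemma gauss_mapE x : 0 < x <= 1 -> x = ((gauss_digit x)%:R + gauss_map x)^-1.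
Proof. by move=> /gauss_mapP[<-]; rewrite invrK. Qed.

Lemma iter_gauss_bounds x n : 0 <= x <= 1 -> 0 <= iter n (@gauss_map R) x <= 1.
Proof.
move=> x01; elim: n => // n /gauss_map_bounds /andP[g0 /ltW g1].
by rewrite iterS g0.
Qed.

(** Induction by two digits at a time, each pair gaining the factor 1/4 of [cf_step_contraction];
    the constant 2 makes the bound for n = 1 equal to 1. *)
Lemma cf_value_gauss_digits n x : 0 <= x <= 1 ->
  (forall k, iter k (@gauss_map R) x != 0) ->
  `|cf_value R (mkseq (fun k => gauss_digit (iter k (@gauss_map R) x)) n) - x|
    <= 2 * 2^-1 ^+ n.
Proof.
elim/ltn_ind: n x => -[|[|n]] IH x /andP[x0 x1] nz.
- by rewrite /= sub0r normrN ger0_norm// mulr1; lra.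
- rewrite expr1 mulfV ?pnatr_eq0//.
  have /andP[v0 v1] : 0 <= cf_value R
      (mkseq (fun k => gauss_digit (iter k (@gauss_map R) x)) 1) <= 1.
    by rewrite cf_value_bounds//= andbT gauss_digit_gt0// x1 lt0r (nz 0%N) x0.
  by rewrite ler_norml; lra.
have x01 : 0 < x <= 1 by rewrite lt0r (nz 0%N) x0.
have /andP[g0 g1] := gauss_map_bounds (introT andP (conj x0 x1)).
have y01 : 0 < gauss_map x <= 1 by rewrite lt0r (nz 1%N) g0 ltW.
set y := gauss_map x in y01 *.
have y01' : 0 <= y <= 1 by rewrite g0 ltW.
have /andP[z0 z1] := gauss_map_bounds y01'.
set z := gauss_map y in z0 z1.
have [_ d1 _] := gauss_mapP x01; have [_ d2 _] := gauss_mapP y01.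
have := IH n (ltnW (ltnSn _)) z; rewrite z0 ltW// => /(_ erefl) IHz.
rewrite !mkseqSl /= [X in _ - X](gauss_mapE x01) [X in _ - (_ + X)^-1](gauss_mapE y01).
rewrite -/y -/z.
set v := cf_value R _ in IHz.
have -> : mkseq (((fun k => gauss_digit (iter k (@gauss_map R) x)) \o succn)
            \o succn) n = mkseq (fun k => gauss_digit (iter k (@gauss_map R) z)) n.
  by apply: eq_map => k /=; rewrite -!iterS !iterSr.
rewrite -/v.
have v0 : 0 <= v.
  suff /cf_value_bounds/andP[] : all (leq 1)
      (mkseq (fun k => gauss_digit (iter k (@gauss_map R) z)) n) by [].
  apply: all_mkseq => k; apply: gauss_digit_gt0.
  have -> : iter k (@gauss_map R) z = iter k.+2 (@gauss_map R) x by rewrite !iterSr.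
  by rewrite lt0r nz andTb; apply: iter_gauss_bounds; rewrite x0.
apply: le_trans (cf_step_contraction d1 d2 v0 z0) _.
move: IHz; rewrite !exprS => H.
have {H} : `|v - z| <= 2 * 2^-1 ^+ n.
  by apply: H => k; rewrite -!iterSr nz.
lra.
Qed.

(** The Gauss digits give the expansion: a finite one, by induction on the time of arrival, if the
    orbit reaches 0, and an infinite one otherwise. *)
Lemma cf_expansion0_exists x : 0 <= x <= 1 -> exists e, cf_expansion0 e x.
Proof.
move=> x01; have [[n]|nz] := pselect (exists n, iter n (@gauss_map R) x = 0).
  elim: n x x01 => [|n IH] x x01 /=; first by move=> ->; exists (Defs.Finite [::]).
  rewrite -iterS iterSr => gn0.
  have [-> |xn0] := eqVneq x 0; first by exists (Defs.Finite [::]).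
  have x01' : 0 < x <= 1 by rewrite lt0r xn0.
  have [_ d1 /andP[g0 /ltW g1]] := gauss_mapP x01'.
  have [|e eg] := IH (gauss_map x) _ gn0; first by rewrite g0.
  exists (cf_cons (gauss_digit x) e).
  by rewrite [X in cf_expansion0 _ X](gauss_mapE x01'); exact: cf_expansion0_cons.
have {}nz k : iter k (@gauss_map R) x != 0 by apply/eqP => k0; apply: nz; exists k.
exists (Infinite (fun k => gauss_digit (iter k (@gauss_map R) x))); split.
  move=> n; apply: gauss_digit_gt0; by rewrite lt0r nz; exact: iter_gauss_bounds.
have h1 : `|2^-1 : R| < 1 by rewrite ger0_norm; lra.
have /cvgr0_norm_le g0 := cvg_geometric 2 h1.
apply/cvgrPdist_le => eps eps0; near=> n; rewrite distrC.
apply: le_trans (cf_value_gauss_digits n x01 nz) _.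
by apply: le_trans (ler_norm _) _; near: n; exact: g0.
Unshelve. all: by end_near. Qed.
End ContinuedFractions.

(** * Lüroth sums and the functional equation of [question_mark] *)

Section LurothSums.
Context {R : realType} (t : nat -> R).
Hypothesis t01 : forall j, (1 <= j)%N -> 0 <= t j <= 1.
Hypothesis tdecr : forall j, (1 <= j)%N -> t j.+1 < t j.
Hypothesis t1 : t 1%N = 1.
Implicit Types (x y z : R) (a d n : nat) (e : cf_digits).

Lemma t_gt0 a : (1 <= a)%N -> 0 < t a.
Proof. by move=> a1; apply: le_lt_trans (tdecr a1); have /andP[] := t01 (ltn0Sn a). Qed.

Lemma t_le1 a : (1 <= a)%N -> t a <= 1.
Proof. by move=> /t01 /andP[]. Qed.

Lemma t_anti a d : (1 <= a)%N -> (a <= d)%N -> t d <= t a.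
Proof.
move=> a1 /subnK <-; elim: (d - a)%N => // n; apply: le_trans.
by rewrite addSn ltW// tdecr// (leq_trans a1)// leq_addl.
Qed.

Definition luroth_width a : R := t a - t a.+1.
Local Notation p := luroth_width.

Lemma luroth_width_gt0 a : (1 <= a)%N -> 0 < p a.
Proof. by move=> /tdecr; rewrite subr_gt0. Qed.

(** A common contraction ratio: for a >= 2 the width [p a] is at most [t 2 = 1 - p 1]. *)
Definition luroth_ratio : R := Num.max (p 1%N) (1 - p 1%N).
Local Notation rho := luroth_ratio.

Lemma luroth_ratio_bounds : 0 < rho < 1.
Proof.
have p0 := luroth_width_gt0 (leqnn 1).
rewrite lt_max p0/= gt_max /p t1 opprB addrCA subrr addr0.
by rewrite -{3}t1 tdecr// andbT ltrBlDr ltrDl t_gt0.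
Qed.

Lemma luroth_width_le a : (1 <= a)%N -> p a <= rho.
Proof.
case: a => [//|[|a]] _; first by rewrite le_max lexx.
rewrite le_max; apply/orP; right.
have := @t_anti 2 a.+2 isT isT; have := @t_gt0 a.+3 isT.
by rewrite /p t1; lra.
Qed.

Lemma luroth_affine_bounds a z : (1 <= a)%N -> 0 <= z <= 1 ->
  t a.+1 <= t a - p a * z <= t a.
Proof.
by move=> /luroth_width_gt0; rewrite /p => ? /andP[? ?]; nra.
Qed.

Lemma luroth_affine_01 a z : (1 <= a)%N -> 0 <= z <= 1 -> 0 <= t a - p a * z <= 1.
Proof.
move=> a1 /(luroth_affine_bounds a1) /andP[h1 h2].
by rewrite (le_trans _ h1) ?(le_trans h2) ?t_le1// ltW// t_gt0.
Qed.

Lemma luroth_term_cons (f : nat -> nat) n :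
  luroth_term t f n.+1 = - p (f 0%N) * luroth_term t (f \o succn) n.
Proof. by rewrite /luroth_term big_ord_recl exprS /= /p; ring. Qed.

(** All terms after the first share the factor minus the first width; here the alternating sum
    becomes an affine recursion. *)
Lemma luroth_series_cons (f : nat -> nat) n :
  series (luroth_term t f) n.+1 =
  t (f 0%N) - p (f 0%N) * series (luroth_term t (f \o succn)) n.
Proof.
rewrite /series /= !big_mkord big_ord_recl; congr (_ + _).
  by rewrite /luroth_term big_ord0 expr0 !mul1r.
rewrite mulr_sumr -sumrN; apply: eq_bigr => i _.
by rewrite luroth_term_cons mulNr.
Qed.

Lemma luroth_series_bounds (f : nat -> nat) n :
  (forall k, (k < n)%N -> (1 <= f k)%N) -> 0 <= series (luroth_term t f) n <= 1.
Proof.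
elim: n f => [|n IH] f f1; first by rewrite /series /= big_geq// lexx ler01.
rewrite luroth_series_cons luroth_affine_01//; first exact: f1.
by apply: IH => k kn; exact: f1.
Qed.

Lemma luroth_term_le (f : nat -> nat) n :
  (forall k, (1 <= f k)%N) -> `|luroth_term t f n| <= rho ^+ n.
Proof.
have /andP[r0 r1] := luroth_ratio_bounds.
elim: n f => [|n IH] f f1.
  rewrite /luroth_term big_ord0 !expr0 !mul1r ger0_norm ?t_le1// ltW// t_gt0//.
rewrite luroth_term_cons normrM normrN exprS ler_pM//.
  by rewrite ger0_norm ?luroth_width_le// ltW// luroth_width_gt0.
by apply: IH => k; exact: f1.
Qed.

Lemma is_cvg_luroth_series (f : nat -> nat) :
  (forall k, (1 <= f k)%N) -> cvgn (series (luroth_term t f)).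
Proof.
move=> f1; have /andP[r0 r1] := luroth_ratio_bounds.
apply: normed_cvg; apply: (@series_le_cvg _ _ (geometric 1 rho)) => [n|n|n|].
- exact: normr_ge0.
- by rewrite /geometric /= mul1r exprn_ge0// ltW.
- by rewrite /geometric /= mul1r; exact: luroth_term_le.
- by apply: is_cvg_geometric_series; rewrite ger0_norm// ltW.
Qed.

Lemma luroth_sum_bounds e x : cf_expansion0 e x -> 0 <= luroth_sum t e <= 1.
Proof.
case: e => [s [/allP s1 _]|f [f1 _]] /=.
  rewrite -(big_mkord xpredT); apply: luroth_series_bounds => k ks.
  by apply: s1; rewrite mem_nth.
have fc := is_cvg_luroth_series f1.
apply/andP; split; [apply: limr_ge|apply: limr_le] => //; near=> n;
  by have /andP[] := @luroth_series_bounds f n (fun k _ => f1 k).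
Unshelve. all: by end_near. Qed.

Lemma luroth_sum_cons d e z : (1 <= d)%N -> cf_expansion0 e z ->
  luroth_sum t (cf_cons d e) = t d - p d * luroth_sum t e.
Proof.
move=> d1; case: e => [s _|f [f1 _]] /=.
  rewrite -(big_mkord xpredT (luroth_term t (nth 0%N (d :: s)))).
  rewrite -(big_mkord xpredT (luroth_term t (nth 0%N s))).
  exact: (luroth_series_cons (nth 0%N (d :: s))).
apply: cvg_lim => //; rewrite -cvg_shiftS.
under eq_fun do rewrite luroth_series_cons.
apply: cvgB; first exact: cvg_cst.
by apply: cvgM; [exact: cvg_cst|exact: is_cvg_luroth_series].
Qed.

Lemma cf_expansion0_of0 e : cf_expansion0 e (0 : R) -> luroth_sum t e = 0.
Proof.
case/cf_expansion0_decons => [[-> _]|[d [r [z [_ d1 /cf_expansion0_bounds/andP[z0 _]]]]]].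
  by rewrite /= big_ord0.
by move/eqP; rewrite eq_sym invr_eq0 gt_eqF// ltr_wpDr// ltr0n.
Qed.

Lemma cf_expansion0_of1 e : cf_expansion0 e (1 : R) -> luroth_sum t e = 1.
Proof.
case/cf_expansion0_decons => [[_ /eqP]|[d [r [z [-> d1 rz]]]]].
  by rewrite oner_eq0.
have /andP[z0 _] := cf_expansion0_bounds rz.
move=> /(congr1 GRing.inv); rewrite invr1 invrK => dz.
have d1' : (d <= 1)%N by rewrite -(ler_nat R); lra.
have {}d1 : d = 1%N by apply/eqP; rewrite eqn_leq d1'.
have z00 : z = 0 by move: dz; rewrite d1; lra.
rewrite z00 in rz.
by rewrite (luroth_sum_cons _ rz) d1// (cf_expansion0_of0 rz) mulr0 subr0.
Qed.

(* Two expansions of the same number have the same first digit, or the number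
   is [d, 1] = [d + 1]; the common first digit can be stripped, which scales
   the difference of the Lüroth sums by at most [rho]. *)
Lemma luroth_sum_unique_approx n x e e' : cf_expansion0 e x -> cf_expansion0 e' x ->
  `|luroth_sum t e - luroth_sum t e'| <= rho ^+ n.
Proof.
have /andP[r0 r1] := luroth_ratio_bounds.
elim: n x e e' => [|n IH] x e e' ex ex'.
  have := luroth_sum_bounds ex; have := luroth_sum_bounds ex'.
  by rewrite ler_norml; lra.
have [x0|x0] := eqVneq x 0.
  by rewrite x0 in ex ex'; rewrite !cf_expansion0_of0// subrr normr0 exprn_ge0// ltW.
case: (cf_expansion0_decons ex) => [[_ /eqP]|]; first by rewrite (negbTE x0).
case=> d [s [z [eE d1 sz xE]]].
case: (cf_expansion0_decons ex') => [[_ /eqP]|]; first by rewrite (negbTE x0).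
case=> d' [s' [z' [eE' d1' sz' xE']]].
wlog dd' : e e' d d' s s' z z' ex ex' eE eE' d1 d1' sz sz' xE xE' / (d <= d')%N.
  move=> wlg; case/orP: (leq_total d d') => dd; last rewrite distrC.
    exact: (wlg e e' d d' s s' z z').
  exact: (wlg e' e d' d s' s z' z).
have /andP[z0 z1] := cf_expansion0_bounds sz.
have /andP[z0' z1'] := cf_expansion0_bounds sz'.
have dz : d%:R + z = d'%:R + z' by rewrite -[LHS]invrK -xE xE' invrK.
rewrite eE eE' (luroth_sum_cons d1 sz) (luroth_sum_cons d1' sz').
have [ddE|] := eqVneq d d'.
  subst d'; have zz : z = z' by apply: addrI dz.
  have -> : t d - p d * luroth_sum t s - (t d - p d * luroth_sum t s') =
      p d * (luroth_sum t s' - luroth_sum t s) by ring.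
  rewrite normrM exprS ler_pM//.
    by rewrite ger0_norm ?luroth_width_le// ltW// luroth_width_gt0.
  by apply: (IH z) => //; rewrite zz.
move=> nd; have dd1 : (d.+1 <= d')%N by rewrite ltn_neqAle nd.
have dd2 : d.+1%:R <= d'%:R :> R by rewrite ler_nat.
rewrite -natr1 in dd2.
have z1E : z = 1 by lra.
have z0E : z' = 0 by lra.
have dE : d' = d.+1.
  by apply/eqP; rewrite eqn_leq dd1 andbT -(ler_nat R) -natr1; lra.
rewrite z1E in sz; rewrite z0E in sz'.
rewrite (cf_expansion0_of1 sz) (cf_expansion0_of0 sz') dE /p mulr1 mulr0 subr0.
by rewrite opprB addrCA !subrr addr0 subrr normr0 exprn_ge0// ltW.
Qed.

Lemma luroth_sum_unique x e e' : cf_expansion0 e x -> cf_expansion0 e' x ->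
  luroth_sum t e = luroth_sum t e'.
Proof.
move=> ex ex'; have /andP[r0 r1] := luroth_ratio_bounds.
apply/eqP; rewrite -subr_eq0 -normr_le0.
have h1 : `|rho| < 1 by rewrite ger0_norm// ltW.
have rc := cvg_geometric 1 h1.
rewrite -(cvg_lim _ rc)//; apply: limr_ge; first by apply/cvg_ex; exists 0.
by near=> n; rewrite /geometric /= mul1r; exact: luroth_sum_unique_approx ex ex'.
Unshelve. all: by end_near. Qed.

(** All expansions of x have the same sum, so the choice made by [xget] is immaterial; the separate
    branch at 0 agrees with the empty string. *)
Lemma question_markE x e : cf_expansion0 e x -> question_mark t x = luroth_sum t e.
Proof.
move=> ex; rewrite /question_mark; case: eqVneq => [x0|x0].
  by rewrite x0 in ex; rewrite (cf_expansion0_of0 ex).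
case: xgetP => [v _ [f /cf_expansionW fx <-]|/(_ (luroth_sum t e))[]].
  exact: luroth_sum_unique fx ex.
by exists e => //; exact: cf_expansion0_neq0.
Qed.

Lemma question_mark0 : question_mark t 0 = 0.
Proof. by rewrite /question_mark eqxx. Qed.

Lemma question_mark_bounds x : 0 <= x <= 1 -> 0 <= question_mark t x <= 1.
Proof.
by move=> /cf_expansion0_exists[e ex]; rewrite (question_markE ex) (luroth_sum_bounds ex).
Qed.

(** From here on this functional equation, the bounds and the values at 0 and 1 replace the
    expansions. *)
Lemma question_mark_cons d x : (1 <= d)%N -> 0 <= x <= 1 ->
  question_mark t (d%:R + x)^-1 = t d - p d * question_mark t x.
Proof.
move=> d1 /cf_expansion0_exists[e ex].
by rewrite (question_markE ex) (question_markE (cf_expansion0_cons d1 ex)) (luroth_sum_cons d1 ex).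
Qed.

Lemma question_mark1 : question_mark t 1 = 1.
Proof.
have := @question_mark_cons 1 0 isT; rewrite addr0 invr1 question_mark0 mulr0 subr0 t1.
by apply; rewrite lexx ler01.
Qed.
End LurothSums.

(** * Monotonicity, semiconjugacy and continuity on [0, 1] *)

Section Homeomorphism.
Context {R : realType} (t : nat -> R).
Hypothesis t01 : forall j, (1 <= j)%N -> 0 <= t j <= 1.
Hypothesis tdecr : forall j, (1 <= j)%N -> t j.+1 < t j.
Hypothesis t1 : t 1%N = 1.
Hypothesis tlim : t j @[j --> \oo] --> 0.
Implicit Types (x y z : R) (a d n : nat).
Local Notation p := (luroth_width t).
Local Notation Q := (question_mark t).

Lemma question_mark_gauss x : 0 < x <= 1 ->
  Q x = t (gauss_digit x) - p (gauss_digit x) * Q (gauss_map x).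
Proof.
move=> x01; have [_ d1 /andP[g0 /ltW g1]] := gauss_mapP x01.
by rewrite {1}(gauss_mapE x01) question_mark_cons// g0.
Qed.

Lemma question_mark_gt0 x : 0 < x <= 1 -> 0 < Q x.
Proof.
move=> x01; have [_ d1 /andP[g0 /ltW g1]] := gauss_mapP x01.
rewrite (question_mark_gauss x01); apply: (@lt_le_trans _ _ (t (gauss_digit x).+1)).
  exact: t_gt0.
have Qb : 0 <= Q (gauss_map x) <= 1 by apply: question_mark_bounds => //; rewrite g0.
by have /andP[] := luroth_affine_bounds tdecr d1 Qb.
Qed.

(** A first digit of at least 2 gives a value of at most [t 2]; with first digit 1 the value is 1
    only if the tail is 0, that is, x = 1. *)
Lemma question_mark_lt1 x : 0 <= x < 1 -> Q x < 1.
Proof.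
move=> /andP[]; rewrite le_eqVlt => /predU1P[<- _|x0 x1].
  by rewrite question_mark0 ltr01.
have x01 : 0 < x <= 1 by rewrite x0 ltW.
have [xE d1 /andP[g0 g1]] := gauss_mapP x01.
rewrite (question_mark_gauss x01).
have Qb : 0 <= Q (gauss_map x) <= 1 by apply: question_mark_bounds => //; rewrite g0 ltW.
have [dE|d2] := eqVneq (gauss_digit x) 1%N; last first.
  have /andP[_ h] := luroth_affine_bounds tdecr d1 Qb.
  apply: le_lt_trans h _; rewrite -[ltRHS]t1.
  apply: le_lt_trans (tdecr (leqnn 1)).
  by apply: t_anti => //; rewrite ltn_neqAle eq_sym d2.
rewrite dE t1 gtrBl mulr_gt0 ?luroth_width_gt0// question_mark_gt0// ltW// andbT.
rewrite lt0r g0 andbT; apply/eqP => gx; move: xE; rewrite dE gx addr0.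
by move/(congr1 GRing.inv); rewrite invrK invr1 => xE; rewrite xE ltxx in x1.
Qed.

(** If the first digits d of x and e of y differ, then d > e and [Q x <= t d <= t e.+1 < Q y],
    strictly since the tail of y has value below 1. Equal digits pass the comparison to the tails,
    with the order reversed. *)
Lemma question_mark_lt_step x y : 0 <= x -> x < y -> y <= 1 ->
  Q x < Q y \/
  exists a u v, [/\ (1 <= a)%N, x = (a%:R + u)^-1, y = (a%:R + v)^-1,
    0 <= v /\ v < u /\ u <= 1 & (Q v < Q u -> Q x < Q y)].
Proof.
rewrite le_eqVlt => /predU1P[<- y0 y1|x0 xy y1].
  by left; rewrite question_mark0 question_mark_gt0// y0.
have x01 : 0 < x <= 1 by rewrite x0 (le_trans _ y1)// ltW.
have y01 : 0 < y <= 1 by rewrite (lt_trans x0).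
have [xE d1 /andP[g0 g1]] := gauss_mapP x01.
have [yE e1 /andP[h0 h1]] := gauss_mapP y01.
have lt_inv : (gauss_digit y)%:R + gauss_map y < (gauss_digit x)%:R + gauss_map x.
  by rewrite -xE -yE ltf_pV2 ?posrE//; case/andP: y01.
have := question_mark_gauss x01; have := question_mark_gauss y01.
move: (gauss_digit x) (gauss_digit y) d1 e1 lt_inv xE yE => d e d1 e1 de xE yE Qy Qx.
have [ed|ed|ed] := ltngtP e d; last 2 first.
- have de1 : d%:R + 1 <= e%:R :> R by rewrite natr1 ler_nat.
  move: de; rewrite ltNge => /negP[]; apply: le_trans (_ : e%:R <= _).
    by apply: le_trans de1; rewrite lerD2l ltW.
  by rewrite lerDl.
- right; subst e; exists d, (gauss_map x), (gauss_map y).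
  rewrite -xE -yE !invrK; split=> //.
    by split=> //; split; [rewrite -(ltrD2l d%:R)|exact: ltW].
  by move=> QQ; rewrite Qx Qy ltrD2l ltrN2 ltr_pM2l// luroth_width_gt0.
left; rewrite Qx Qy.
have Qbx : 0 <= Q (gauss_map x) <= 1 by apply: question_mark_bounds => //; rewrite g0 ltW.
have Qby : 0 <= Q (gauss_map y) < 1.
  rewrite question_mark_lt1 ?h0// andbT.
  have y01' : 0 <= gauss_map y <= 1 by rewrite h0 ltW.
  by have /andP[] := question_mark_bounds t01 tdecr t1 y01'.
have /andP[_ le1] := luroth_affine_bounds tdecr d1 Qbx.
apply: le_lt_trans le1 _; apply: le_lt_trans (t_anti tdecr _ ed) _ => //.
rewrite -[ltLHS](subKr (t e)) ltrD2l ltrN2 -/(luroth_width t e).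
by rewrite gtr_pMr ?luroth_width_gt0//; case/andP: Qby.
Qed.

(* Stripping two equal digits multiplies the distance by at least 4, so two
   distinct points are eventually separated by their digits. *)
Lemma question_mark_lt x y : 0 <= x -> x < y -> y <= 1 -> Q x < Q y.
Proof.
move=> x0 xy y1.
have h1 : `|4^-1 : R| < 1 by rewrite ger0_norm; lra.
have yx0 : 0 < y - x by rewrite subr_gt0.
have [n] : exists n, 4^-1 ^+ n < y - x.
  have /cvgr0_norm_lt/(_ _ yx0)[n _ /(_ n (leqnn n))] := cvg_geometric 1 h1.
  by rewrite /geometric /= mul1r ger0_norm ?exprn_ge0//; exists n.
elim: n x y x0 xy y1 {yx0} => [|n IH] x y x0 xy y1; first by rewrite expr0; lra.
move=> hn; have [//|[a [u [v [a1 xE yE [v0 [vu u1]]]]]]] := question_mark_lt_step x0 xy y1.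
(* The second stripping restores the original order, so the induction hypothesis applies to
   [v' < u']. *)
apply; have [//|[b [u' [v' [b1 vE uE [v'0 [vu' u'1]]]]]]] := question_mark_lt_step v0 vu u1.
apply; apply: IH => //.
have u'0 : 0 <= u' by lra.
have := cf_step_contraction a1 b1 u'0 v'0.
rewrite -uE -vE -xE -yE ger0_norm; last by lra.
rewrite ger0_norm; last by lra.
by move: hn; rewrite exprS; lra.
Qed.

(** The digit is the least a with [t a.+1 < w]; it is positive because [t 1 = 1]. *)
Lemma luroth_digit_exists w : 0 < w <= 1 -> exists2 a, (1 <= a)%N & t a.+1 < w <= t a.
Proof.
move=> /andP[w0 w1].
have ex : exists n, t n.+1 < w.
  have /cvgr0_norm_lt/(_ _ w0)[n _ nt] := tlim; exists n.
  by have := nt n.+1 (leqnSn n) ; apply: le_lt_trans; exact: ler_norm.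
case: (ex_minnP ex) => [[|n] tw nmin]; first by rewrite t1 ltNge w1 in tw.
exists n.+1 => //; rewrite tw leNgt /=; apply/negP => /nmin.
by rewrite ltnn.
Qed.

Lemma luroth_digit_inj w a d : (1 <= a)%N -> (1 <= d)%N ->
  t a.+1 < w <= t a -> t d.+1 < w <= t d -> a = d.
Proof.
wlog : a d / (a <= d)%N.
  by case/orP: (leq_total a d) => ad wlg a1 d1 aw dw; [|apply/esym]; exact: wlg.
rewrite leq_eqVlt => /predU1P[//|ad] a1 d1 /andP[aw _] /andP[_ wd].
have := lt_le_trans aw wd; rewrite ltNge (t_anti tdecr)//.
Qed.

Lemma luroth_mapE w a : (1 <= a)%N -> t a.+1 < w <= t a ->
  luroth_map t w = (t a - w) / p a.
Proof.
move=> a1 aw; have w0 : 0 < w.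
  by case/andP: aw => + _; apply: lt_trans; exact: t_gt0.
rewrite /luroth_map gt_eqF//.
case: xgetP => [d _ [d1 dw]|/(_ a)[]//].
by rewrite (luroth_digit_inj d1 a1 dw aw).
Qed.

(** Since [gauss_map x < 1], the value [Q x] stays strictly above [t d.+1], d being the first digit,
    and so lies in the half-open interval on which [luroth_map] inverts the branch of d. *)
Lemma question_mark_semiconj x : 0 <= x <= 1 ->
  luroth_map t (Q x) = Q (gauss_map x).
Proof.
move=> /andP[]; rewrite le_eqVlt => /predU1P[<- _|x0 x1].
  by rewrite gauss_map0 question_mark0 /luroth_map eqxx.
have x01 : 0 < x <= 1 by rewrite x0.
have [_ d1 /andP[g0 g1]] := gauss_mapP x01.
have p0 := luroth_width_gt0 tdecr d1.
rewrite (question_mark_gauss x01) (@luroth_mapE _ (gauss_digit x))//.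
  by rewrite opprB addrCA subrr addr0 mulrAC divff ?mul1r// gt_eqF.
have Qb : 0 <= Q (gauss_map x) <= 1 by apply: question_mark_bounds => //; rewrite g0 ltW.
have /andP[_ ->] := luroth_affine_bounds tdecr d1 Qb.
have Q1 : Q (gauss_map x) < 1 by rewrite question_mark_lt1// g0.
by rewrite andbT; move: p0; rewrite /luroth_width; nra.
Qed.

(** The first n Lüroth digits of w are used as continued fraction digits; each of them shrinks the
    error by the contraction ratio. *)
Lemma question_mark_dense_approx n w : 0 <= w <= 1 ->
  exists2 x, 0 <= x <= 1 & `|Q x - w| <= luroth_ratio t ^+ n.
Proof.
have /andP[r0 r1] := luroth_ratio_bounds t01 tdecr t1.
elim: n w => [|n IH] w /andP[w0 w1].
  exists 0; first by rewrite lexx ler01.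
  by rewrite question_mark0 sub0r normrN ger0_norm.
move: w0; rewrite le_eqVlt => /predU1P[<-|w0].
  exists 0; first by rewrite lexx ler01.
  by rewrite question_mark0 subrr normr0 exprn_ge0// ltW.
have [|a a1 aw] := @luroth_digit_exists w; first by rewrite w0.
have p0 := luroth_width_gt0 tdecr a1.
have [|z z01 zv] := IH ((t a - w) / p a).
  case/andP: aw => aw wa; apply/andP; split.
    by apply: divr_ge0; [rewrite subr_ge0|exact: ltW].
  by rewrite ler_pdivrMr// mul1r lerD2l lerN2 ltW.
exists (a%:R + z)^-1.
  have /andP[z0 z1] := z01; have ? : 1 <= a%:R :> R by rewrite ler1n.
  by apply/andP; split; [rewrite invr_ge0; lra|rewrite invf_le1; lra].
rewrite question_mark_cons//.
have -> : t a - p a * Q z - w = - (p a * (Q z - (t a - w) / p a)).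
  by field; rewrite gt_eqF.
rewrite normrN normrM exprS ler_pM// ger0_norm ?luroth_width_le//; exact: ltW.
Qed.

Lemma question_mark_dense w w' : 0 <= w -> w < w' -> w' <= 1 ->
  exists2 x, 0 <= x <= 1 & w < Q x < w'.
Proof.
move=> w0 ww w1; have /andP[r0 r1] := luroth_ratio_bounds t01 tdecr t1.
have h1 : `|luroth_ratio t| < 1 by rewrite ger0_norm// ltW.
have d0 : 0 < (w' - w) / 2 by lra.
have [n] : exists n, luroth_ratio t ^+ n < (w' - w) / 2.
  have /cvgr0_norm_lt/(_ _ d0)[n _ /(_ n (leqnn n))] := cvg_geometric 1 h1.
  by rewrite /geometric /= mul1r ger0_norm ?exprn_ge0 ?(ltW r0)//; exists n.
have [|x x01 xw] := @question_mark_dense_approx n ((w + w') / 2); first by lra.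
move=> /(le_lt_trans xw) {xw}; rewrite ltr_norml => xw.
by exists x => //; lra.
Qed.

(** The preimage is the supremum of the points with value at most w; were its value different from
    w, density would give a value strictly between, against monotonicity. *)
Lemma question_mark_surj w : 0 <= w <= 1 -> exists2 x, 0 <= x <= 1 & Q x = w.
Proof.
move=> /andP[w0 w1].
pose S := [set x | 0 <= x <= 1 /\ Q x <= w].
have S0 : S 0 by rewrite /S/= question_mark0 lexx ler01.
have Sub : has_ubound S by exists 1 => x [/andP[]].
have x01 : 0 <= sup S <= 1.
  rewrite ub_le_sup//=; apply: ge_sup; first by exists 0.
  by move=> x [/andP[]].
have Qb := question_mark_bounds t01 tdecr t1 x01.
have [Qlt|Qgt|QE] := ltgtP (Q (sup S)) w; last by exists (sup S).
- have [z /andP[z0 z1] /andP[z2 z3]] := question_mark_dense (proj1 (andP Qb)) Qlt w1.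
  have : z <= sup S by apply: ub_le_sup => //; rewrite /S/= z0 z1 ltW.
  rewrite le_eqVlt => /predU1P[zE|zS]; first by rewrite zE ltxx in z2.
  by have := question_mark_lt z0 zS (proj2 (andP x01)); rewrite ltNge ltW.
- have [z /andP[z0 z1] /andP[z2 z3]] := question_mark_dense w0 Qgt (proj2 (andP Qb)).
  have zS : z < sup S.
    rewrite ltNge le_eqVlt; apply/negP => /predU1P[zE|zS]; first by rewrite zE ltxx in z3.
    by have := question_mark_lt (proj1 (andP x01)) zS z1; rewrite ltNge ltW.
  have [x [/andP[x0 x1] xw] zx] := sup_gt (ex_intro _ 0 S0) zS.
  have := question_mark_lt z0 zx x1.
  by rewrite ltNge (ltW (le_lt_trans xw z2)).
Qed.

Lemma question_mark_mono : {in `[0, 1] &, {mono Q : x y / x <= y}}.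
Proof.
apply: le_mono_in => x y; rewrite !in_itv /= => /andP[x0 _] /andP[_ y1] xy.
exact: question_mark_lt.
Qed.

Lemma question_mark_continuous : {within `[0, 1], continuous Q}.
Proof.
apply: segment_inc_surj_continuous; first exact: question_mark_mono.
rewrite question_mark0 (question_mark1 t01 tdecr t1) => w /=.
by rewrite in_itv /= => /question_mark_surj[x x01 xw]; exists x.
Qed.

Lemma question_mark_homeomorphism :
  homeomorphism_on (`[0, 1] : set R) (`[0, 1] : set R) Q.
Proof.
have Qinj : set_inj `[0, 1] Q.
  by move=> x y /set_mem xI /set_mem yI; apply: (inc_inj_in question_mark_mono).
have Qsurj : set_surj `[0, 1] `[0, 1] Q.
  move=> w /=; rewrite in_itv /= => /question_mark_surj[x x01 xw].
  by exists x.
split; last 2 first.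
- exact: question_mark_continuous.
- pose g := 'pinv_(fun=> 0) (`[0, 1]%classic : set R) Q.
  have QgK : {in (`[0, 1]%classic : set R), cancel Q g} by apply: pinvKV.
  have gQK : {in (`[0, 1]%classic : set R), cancel g Q}.
    by move=> w /set_mem/Qsurj wQ; apply: pinvK; rewrite inE.
  exists g; split => //.
  have := @segment_can_le_continuous R 0 1 Q g ler01 question_mark_continuous.
  rewrite question_mark0 (question_mark1 t01 tdecr t1); apply.
  by move=> x xI; apply: QgK; rewrite inE.
split=> // x /=; rewrite !in_itv/=; exact: question_mark_bounds.
Qed.
End Homeomorphism.

(** * Lagrange's theorem on Gauss orbits of quadratic irrationals *)

Section Rationality.
Context {R : realType}.
Implicit Types (x y z : R).

Lemma rationalD x y : rational x -> rational y -> rational (x + y).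
Proof. by move=> [a _ <-] [b _ <-]; exists (a + b) => //; rewrite rmorphD. Qed.

Lemma rationalN x : rational x -> rational (- x).
Proof. by move=> [a _ <-]; exists (- a) => //; rewrite rmorphN. Qed.

Lemma rationalM x y : rational x -> rational y -> rational (x * y).
Proof. by move=> [a _ <-] [b _ <-]; exists (a * b) => //; rewrite rmorphM. Qed.

Lemma rationalV x : rational x -> rational x^-1.
Proof. by move=> [a _ <-]; exists a^-1 => //; rewrite fmorphV. Qed.

Lemma rational_int (m : int) : rational (m%:~R : R).
Proof. by exists m%:~R => //; rewrite ratr_int. Qed.

(** The last clause is the estimate |x - p/q| <= 1/q^2 with the denominators cleared. *)
Let near_convergent x (p q : int) :=
  [/\ 0 <= p, p <= q & q%:~R * `|q%:~R * x - p%:~R| <= 1].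

(** The fractions p/q and p'/q' are consecutive convergents, starting from 1/d and 0/1 and continued
    by the usual recursion. Squaring the determinant hides its alternating sign. *)
Lemma near_convergent_exists x n : 0 <= x <= 1 ->
  (forall k, iter k (@gauss_map R) x != 0) ->
  exists p q p' q' : int, let y := iter n.+1 (@gauss_map R) x in
    [/\ x * (q%:~R + q'%:~R * y) = p%:~R + p'%:~R * y,
        (p * q' - p' * q) ^+ 2 = 1, near_convergent x p q & near_convergent x p' q'].
Proof.
move=> /andP[x0 x1] nz.
have orb k : 0 < iter k (@gauss_map R) x <= 1.
  by rewrite lt0r nz andTb; apply: iter_gauss_bounds; rewrite x0.
elim: n => [|n [p [q [p' [q' [xE det [p0 pq pqx] [p'0 pq' pqx']]]]]]].
  have [xE d1 /andP[g0 g1]] := gauss_mapP (orb 0%N).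
  rewrite /= in xE d1 g0 g1 *.
  have x0' : x != 0 := nz 0%N.
  have hx : x * ((gauss_digit x)%:R + gauss_map x) = 1 by rewrite -xE divff.
  exists 1, (gauss_digit x)%:Z, 0, 1; split => //=.
  - by rewrite -pmulrn !mulr1z mulr0z mul0r addr0 mul1r.
  - split => //; rewrite -pmulrn mulr1z.
    set d := (gauss_digit x)%:R in hx *.
    have d0 : 0 <= d :> R by exact: ler0n.
    have -> : d * x - 1 = - (x * gauss_map x) by rewrite -hx; ring.
    rewrite normrN ger0_norm; last exact: mulr_ge0.
    rewrite -hx mulrCA ler_wpM2l//.
    by apply: le_trans (_ : d <= _); [rewrite ler_piMr// ltW|rewrite lerDl].
  - by split=> //; rewrite !mul1r mulr0z subr0 ger0_norm.
set y := iter n.+1 _ x in xE.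
have [yE d1 /andP[g0 g1]] := gauss_mapP (orb n.+1).
have y0 : y != 0 := nz n.+1.
rewrite [iter n.+2 _ x]iterS -/y in yE d1 g0 g1 *.
set z := gauss_map y in yE g0 g1 *; set d := gauss_digit y in yE d1.
have hy : y * (d%:R + z) = 1 by rewrite -yE divff.
pose p1 := d%:Z * p + p'; pose q1 := d%:Z * q + q'.
have p1E : p1%:~R = d%:R * p%:~R + p'%:~R :> R by rewrite /p1 rmorphD rmorphM /= -pmulrn.
have q1E : q1%:~R = d%:R * q%:~R + q'%:~R :> R by rewrite /q1 rmorphD rmorphM /= -pmulrn.
have q0 : 0 <= q by exact: le_trans pq.
have q'0 : 0 <= q' by exact: le_trans pq'.
have q10 : 0 <= q1 by rewrite addr_ge0// mulr_ge0.
have xE1 : x * (q1%:~R + q%:~R * z) = p1%:~R + p%:~R * z.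
  have -> : q1%:~R + q%:~R * z = (q%:~R + q'%:~R * y) * (d%:R + z).
    by rewrite q1E [RHS]mulrDl -(mulrA q'%:~R) hy; ring.
  by rewrite mulrA xE p1E [LHS]mulrDl -(mulrA p'%:~R) hy; ring.
have det1 : (p1 * q - p * q1) ^+ 2 = 1 by rewrite -det /p1 /q1; ring.
exists p1, q1, p, q; split=> //; split.
- by rewrite addr_ge0// mulr_ge0.
- by rewrite lerD// ler_wpM2l.
have detR : `|p1%:~R * q%:~R - p%:~R * q1%:~R| = 1 :> R.
  apply/eqP; rewrite -sqrp_eq1// -normrX -!intrM -intrB -rmorphXn /= det1.
  by rewrite normr1.
(* As the determinant is 1 or -1, this bounds the error of the new convergent by z <= 1. *)
have zE : (q1%:~R * x - p1%:~R) * (q1%:~R + q%:~R * z) =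
   z * (p%:~R * q1%:~R - p1%:~R * q%:~R).
  rewrite mulrBl -mulrA xE1; ring.
have q1R : 0 <= q1%:~R :> R by rewrite ler0z.
have qR : 0 <= q%:~R :> R by rewrite ler0z.
have hq1 : q1%:~R <= `|q1%:~R + q%:~R * z|.
  by apply: le_trans (ler_norm _); rewrite lerDl mulr_ge0.
apply: (@le_trans _ _ z); last exact: ltW.
have -> : z = `|z * (p%:~R * q1%:~R - p1%:~R * q%:~R)|.
  by rewrite normrM distrC detR mulr1 ger0_norm.
by rewrite -zE normrM mulrC ler_wpM2l.
Qed.

(** Subtracting q^2 times the equation of x factors the form as (p - q x)(a (p + q x) + b q); the
    second factor is at most q (2|a| + |b|), and q |p - q x| <= 1. *)
Lemma near_convergent_form_le x p q (a b c : int) : 0 <= x <= 1 ->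
  a%:~R * x ^+ 2 + b%:~R * x + c%:~R = 0 -> near_convergent x p q ->
  `|a * p ^+ 2 + b * p * q + c * q ^+ 2| <= 2 * `|a| + `|b|.
Proof.
move=> /andP[x0 x1] root [p0 pq qx]; rewrite -(ler_int R) intr_norm.
have -> : (a * p ^+ 2 + b * p * q + c * q ^+ 2)%:~R =
    a%:~R * p%:~R ^+ 2 + b%:~R * p%:~R * q%:~R + c%:~R * q%:~R ^+ 2 :> R by ring.
have -> : (2 * `|a| + `|b|)%:~R = 2 * `|a%:~R| + `|b%:~R| :> R.
  by rewrite -!intr_norm; ring.
have qR : 0 <= q%:~R :> R by rewrite ler0z (le_trans p0).
have pR : 0 <= p%:~R :> R by rewrite ler0z.
have pqR : p%:~R <= q%:~R :> R by rewrite ler_int.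
move: root qx qR pR pqR; move: (a%:~R : R) (b%:~R : R) (c%:~R : R) (p%:~R : R) (q%:~R : R).
move=> {a b c p q p0 pq} a b c p q root qx q0 p0 pq.
have -> : a * p ^+ 2 + b * p * q + c * q ^+ 2 = (p - q * x) * (a * (p + q * x) + b * q).
  have -> : c = - (a * x ^+ 2 + b * x) by apply/eqP; rewrite -addr_eq0 addrC root.
  by ring.
have h : `|a * (p + q * x) + b * q| <= q * (2 * `|a| + `|b|).
  apply: le_trans (ler_normD _ _) _; rewrite !normrM (ger0_norm q0) mulrDr.
  rewrite [q * `|b|]mulrC lerD2r mulrCA mulrA mulrC ler_wpM2r// ger0_norm; last nra.
  nra.
rewrite normrM -normrN opprB; apply: le_trans (ler_wpM2l (normr_ge0 _) h) _.
rewrite mulrA [_ * q]mulrC ler_piMl// addr_ge0// mulr_ge0//.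
Qed.

(* Lagrange: substituting x = (p + p' y) / (q + q' y) turns the equation of x
   into one for y = G^(n+1) x with the same discriminant, whose outer
   coefficients are values of the form at convergents, hence bounded. *)
Lemma gauss_orbit_quadratic x (a b c : int) : 0 <= x <= 1 ->
  (forall k, iter k (@gauss_map R) x != 0) ->
  a%:~R * x ^+ 2 + b%:~R * x + c%:~R = 0 ->
  exists M : nat, forall n, exists a' b' c' : int,
    let y := iter n.+1 (@gauss_map R) x in
    [/\ (`|a'| <= M)%N, (`|b'| <= M)%N, (`|c'| <= M)%N,
        b' ^+ 2 - 4 * a' * c' = b ^+ 2 - 4 * a * c &
        a'%:~R * y ^+ 2 + b'%:~R * y + c'%:~R = 0].
Proof.
move=> x01 nz root.
pose K : int := 2 * `|a| + `|b|; pose D := b ^+ 2 - 4 * a * c.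
have K0 : 0 <= K by rewrite addr_ge0// mulr_ge0.
pose M : int := K + `|D| + 4 * K ^+ 2.
exists (absz M) => n.
have [p [q [p' [q' [xE det pq pq']]]]] := near_convergent_exists n x01 nz.
pose a' := a * p' ^+ 2 + b * p' * q' + c * q' ^+ 2.
pose b' := 2 * a * p * p' + b * (p * q' + p' * q) + 2 * c * q * q'.
pose c' := a * p ^+ 2 + b * p * q + c * q ^+ 2.
have aK : `|a'| <= K by exact: near_convergent_form_le root pq'.
have cK : `|c'| <= K by exact: near_convergent_form_le root pq.
(* The substitution multiplies the discriminant by the square of its determinant. *)
have DE : b' ^+ 2 - 4 * a' * c' = D.
  transitivity ((p * q' - p' * q) ^+ 2 * D); last by rewrite det mul1r.
  by rewrite /D /a' /b' /c'; ring.
have le_absz (m : int) : `|m| <= M -> (absz m <= absz M)%N.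
  by move=> h; rewrite -lez_nat !abszE; apply: le_trans h (ler_norm _).
have D0 : 0 <= `|D| by [].
have K2 : 0 <= K ^+ 2 by exact: exprn_ge0.
exists a', b', c'; split => //.
- by apply: le_absz; rewrite /M; lra.
(* For an integer |b'| <= b'^2, and b'^2 = D + 4 a' c' is bounded through the outer coefficients. *)
- apply: le_absz; apply: le_trans (_ : `|b'| ^+ 2 <= _).
    by have : 0 <= `|b'| by []; case: `|b'| => // -[|m] _ //; rewrite expr2 ler_peMr.
  have -> : `|b'| ^+ 2 = D + 4 * (a' * c') by rewrite real_normK ?num_real// -DE; ring.
  have : `|a' * c'| <= K * K by rewrite normrM ler_pM.
  have := ler_norm D; have := ler_norm (a' * c').
  rewrite /M; move: (a' * c') => m; rewrite expr2; nra.
- by apply: le_absz; rewrite /M; lra.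
set y := iter _ _ x in xE *.
apply/esym; transitivity ((q%:~R + q'%:~R * y) ^+ 2 * (a%:~R * x ^+ 2 + b%:~R * x + c%:~R)).
  by rewrite root mulr0.
set s := q%:~R + q'%:~R * y in xE *.
transitivity (a%:~R * (x * s) ^+ 2 + b%:~R * (x * s) * s + c%:~R * s ^+ 2); first by ring.
by rewrite xE /s /a' /b' /c'; ring.
Qed.

(** The number 2 a x + b is a square root of the discriminant, so its sign tells the two roots
    apart; for a = 0 the equation is linear with b nonzero. *)
Lemma quadratic_root_inj (a b c : int) x y : b ^+ 2 - 4 * a * c != 0 ->
  a%:~R * x ^+ 2 + b%:~R * x + c%:~R = 0 ->
  a%:~R * y ^+ 2 + b%:~R * y + c%:~R = 0 ->
  (0 <= 2 * a%:~R * x + b%:~R) = (0 <= 2 * a%:~R * y + b%:~R) -> x = y.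
Proof.
move=> D0 rx ry sgn.
have {}D0 : b%:~R ^+ 2 - 4 * a%:~R * c%:~R != 0 :> R.
  move: D0; rewrite -(intr_eq0 R).
  by have -> : (b ^+ 2 - 4 * a * c)%:~R = b%:~R ^+ 2 - 4 * a%:~R * c%:~R :> R by ring.
move: D0 rx ry sgn; move: (a%:~R : R) (b%:~R : R) (c%:~R : R) => {a b c} a b c.
move=> D0 rx ry sgn.
have sq z : a * z ^+ 2 + b * z + c = 0 -> (2 * a * z + b) ^+ 2 = b ^+ 2 - 4 * a * c.
  by move=> rz; rewrite -[RHS]addr0 -(mulr0 (4 * a)) -rz; ring.
have w : 2 * a * x + b = 2 * a * y + b.
  have : `|2 * a * x + b| = `|2 * a * y + b|.
    by apply/eqP; rewrite -(@eqrXn2 _ 2)// !real_normK ?num_real// (sq x)// (sq y).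
  move: sgn; case: (lerP 0 (2 * a * x + b)) => hx /esym; first by move=> hy; rewrite !ger0_norm.
  by move/negbT; rewrite -ltNge => hy; rewrite !ltr0_norm// => /oppr_inj.
have [a0|a0] := eqVneq a 0; last first.
  by apply: (mulfI (mulf_neq0 (lt0r_neq0 (ltr0Sn R 1)) a0)); exact: addIr w.
have b0 : b != 0 by apply: contra_neq D0 => ->; rewrite a0; ring.
apply: (mulfI b0); apply: (addIr c).
by move: rx ry; rewrite a0 !mul0r !add0r => -> ->.
Qed.

(** Pigeonhole: the bounded coefficients and the sign that selects the root form a finite set of
    keys, and equal keys mean equal orbit points. *)
Lemma gauss_orbit_eventually_periodic x (a b c : int) : 0 <= x <= 1 ->
  (forall k, iter k (@gauss_map R) x != 0) ->
  a%:~R * x ^+ 2 + b%:~R * x + c%:~R = 0 -> b ^+ 2 - 4 * a * c != 0 ->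
  exists m k : nat, iter k.+1 (@gauss_map R) (iter m (@gauss_map R) x) =
                    iter m (@gauss_map R) x.
Proof.
move=> x01 nz root D0; have [M HM] := gauss_orbit_quadratic x01 nz root.
have {HM}[f fP] := choice HM.
have {fP}[g gP] := choice fP.
have {gP}[h hP] := choice gP.
pose Y n := iter n.+1 (@gauss_map R) x.
(* The shift by [M] moves coefficients from [-M, M] to [0, 2M]. *)
pose enc (m : int) : 'I_(M + M).+1 := inord `|m + M%:Z|.
have encI (u v : int) : (`|u| <= M)%N -> (`|v| <= M)%N -> enc u = enc v -> u = v.
  move=> uM vM /(congr1 (@nat_of_ord _)); rewrite !inordK; lia.
pose T := ('I_(M + M).+1 * 'I_(M + M).+1 * 'I_(M + M).+1 * bool)%type.
pose key (i : 'I_(#|{: T}|.+1)) : T :=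
  (enc (f i), enc (g i), enc (h i), 0 <= 2 * (f i)%:~R * Y i + (g i)%:~R).
have /injectivePn[i [j ij [e1 e2 e3 e4]]] : ~~ injectiveb key.
  by apply/negP => /injectiveP/leq_card; rewrite card_ord ltnn.
have [fi gi hi DE ri] := hP i; have [fj gj hj _ rj] := hP j.
have {}e1 := encI _ _ fi fj e1; have {}e2 := encI _ _ gi gj e2.
have {}e3 := encI _ _ hi hj e3.
have YE : Y i = Y j.
  rewrite -e1 -e2 -e3 in rj; rewrite -e1 -e2 in e4.
  by apply: (quadratic_root_inj _ ri rj e4); rewrite DE.
have {ij} : i != j :> nat by [].
have per (u v : nat) : (u < v)%N -> Y u = Y v ->
    iter (v - u.+1).+1 (@gauss_map R) (iter u.+1 (@gauss_map R) x) = iter u.+1 (@gauss_map R) x.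
  move=> uv YY; rewrite -iterD -subSn// subSS addnS subnK; last exact: ltnW.
  exact/esym.
case: ltngtP => // lt_ij _.
- by exists i.+1, (j - i.+1)%N; exact: per.
- by exists j.+1, (i - j.+1)%N; exact: per.
Qed.
End Rationality.

(** * Rational values at rationals and quadratic surds *)

Section RationalValues.
Context {R : realType} (t : nat -> R).
Hypothesis t01 : forall j, (1 <= j)%N -> 0 <= t j <= 1.
Hypothesis tdecr : forall j, (1 <= j)%N -> t j.+1 < t j.
Hypothesis t1 : t 1%N = 1.
Hypothesis tQ : forall j, (1 <= j)%N -> rational (t j).
Implicit Types (x y z : R) (a d n : nat).
Local Notation p := (luroth_width t).
Local Notation Q := (question_mark t).

Lemma rational_luroth_width a : (1 <= a)%N -> rational (p a).
Proof. by move=> a1; apply: rationalD; [|apply: rationalN]; apply: tQ. Qed.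

Lemma rational_question_mark_gauss x : 0 <= x <= 1 ->
  rational (Q (gauss_map x)) -> rational (Q x).
Proof.
move=> /andP[]; rewrite le_eqVlt => /predU1P[<-|x0 x1 gQ].
  by rewrite gauss_map0.
have x01 : 0 < x <= 1 by rewrite x0.
rewrite question_mark_gauss//; have d1 := gauss_digit_gt0 x01.
apply: rationalD; first exact: tQ.
by apply/rationalN/rationalM => //; exact: rational_luroth_width.
Qed.

Lemma rational_question_mark_iter x n : 0 <= x <= 1 ->
  rational (Q (iter n (@gauss_map R) x)) -> rational (Q x).
Proof.
move=> x01; elim: n => // n IH /rational_question_mark_gauss h.
by apply/IH/h/iter_gauss_bounds.
Qed.

(** Euclid's algorithm: for x = m/n with first digit d, [gauss_map x] is (n - d m)/m, with
    denominator m < n. *)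
Lemma rational_question_mark_fraction n (m : nat) x : (0 < n)%N -> 0 <= x <= 1 ->
  x * n%:R = m%:R -> rational (Q x).
Proof.
elim/ltn_ind: n m x => n IH m x n0 /andP[x0 x1] xn.
have [->|xn0] := eqVneq x 0; first by rewrite question_mark0; exact: (rational_int 0).
have [->|xn1] := eqVneq x 1.
  by rewrite question_mark1//; exact: (rational_int 1).
have x01 : 0 < x <= 1 by rewrite lt0r xn0 x0.
have xlt1 : x < 1 by rewrite lt_neqAle xn1.
have nR : 0 < n%:R :> R by rewrite ltr0n.
have m0 : (0 < m)%N by rewrite -(ltr0n R) -xn mulr_gt0//; case/andP: x01.
have mn : (m < n)%N by rewrite -(ltr_nat R) -xn gtr_pMl.
have [xE d1 /andP[g0 g1]] := gauss_mapP x01.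
apply: rational_question_mark_gauss; first by rewrite x0.
have gm : gauss_map x * m%:R + (gauss_digit x * m)%:R = n%:R.
  by rewrite natrM -mulrDl addrC -xE -xn mulKf.
have dm : (gauss_digit x * m <= n)%N.
  by rewrite -(ler_nat R) -gm lerDr mulr_ge0.
apply: (IH m mn (n - gauss_digit x * m)%N) => //; first by rewrite g0 ltW.
by rewrite natrB// -gm addrK.
Qed.

Lemma rational_question_mark_rational x : 0 <= x <= 1 -> rational x -> rational (Q x).
Proof.
move=> x01 /rationalP[a [b xE]].
have [b0|b0] := posnP b.
  by rewrite xE b0 invr0 mulr0 question_mark0; exact: (rational_int 0).
have bR : 0 < b%:R :> R by rewrite ltr0n.
have xb : x * b%:R = a%:~R by rewrite xE divfK// gt_eqF.
have a0 : 0 <= a by rewrite -(ler0z R) -xb mulr_ge0//; case/andP: x01.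
apply: (@rational_question_mark_fraction b `|a|%N) => //.
by rewrite xb -{1}(gez0_abs a0) pmulrn.
Qed.

(** The n branches along the orbit compose to an affine map; at 0, which has no branch, the zero map
    serves. *)
Lemma question_mark_iter_affine n x : 0 <= x <= 1 ->
  exists c s : R, [/\ rational c, rational s, `|s| <= luroth_ratio t ^+ n &
    Q x = c + s * Q (iter n (@gauss_map R) x)].
Proof.
have /andP[r0 r1] := luroth_ratio_bounds t01 tdecr t1.
elim: n x => [|n IH] x x01.
  exists 0, 1; rewrite normr1 expr0 lexx add0r mul1r.
  by split=> //; [exact: (rational_int 0)|exact: (rational_int 1)].
have [->|xn0] := eqVneq x 0.
  exists 0, 0; rewrite question_mark0 normr0 mul0r addr0 exprn_ge0 ?(ltW r0)//.
  by split=> //; exact: (rational_int 0).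
have x01' : 0 < x <= 1 by rewrite lt0r xn0.
have [_ d1 /andP[g0 /ltW g1]] := gauss_mapP x01'.
have [|c [s [cQ sQ sr QE]]] := IH (gauss_map x); first by rewrite g0.
set d := gauss_digit x in d1.
exists (t d - p d * c), (- (p d * s)); split.
- apply: rationalD; first exact: tQ.
  by apply/rationalN/rationalM => //; exact: rational_luroth_width.
- by apply/rationalN/rationalM => //; exact: rational_luroth_width.
- rewrite normrN normrM exprS ler_pM// ger0_norm ?luroth_width_le//.
  by rewrite ltW// luroth_width_gt0.
- rewrite question_mark_gauss// -/d QE iterSr; ring.
Qed.

Lemma rational_question_mark_periodic n x : 0 <= x <= 1 ->
  iter n.+1 (@gauss_map R) x = x -> rational (Q x).
Proof.
move=> x01 xper; have [c [s [cQ sQ sr]]] := question_mark_iter_affine n.+1 x01.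
rewrite xper => QE; have /andP[r0 r1] := luroth_ratio_bounds t01 tdecr t1.
(* The period is positive, so the slope is bounded by a positive power of the ratio. *)
have s1 : s < 1.
  apply: le_lt_trans (ler_norm _) _; apply: le_lt_trans sr _.
  by rewrite exprn_ilt1 ?ltW.
have s1' : 1 - s != 0 by rewrite subr_eq0 gt_eqF.
have -> : Q x = c / (1 - s).
  by apply: (mulIf s1'); rewrite divfK// mulrBr mulr1 {1}QE; ring.
apply: rationalM => //; apply: rationalV; apply: rationalD; last exact: rationalN.
exact: (rational_int 1).
Qed.

(** Reducible polynomials are allowed, so besides the periodic case there are orbits that reach 0
    and a zero discriminant, where x = -b/(2a) is rational. *)
Lemma rational_question_mark_surd x : 0 <= x <= 1 -> quadratic_surd x -> rational (Q x).
Proof.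
move=> x01 [P [sP Px]].
pose a := P`_2; pose b := P`_1; pose c := P`_0.
have a0 : a != 0.
  have : lead_coef P != 0 by rewrite lead_coef_eq0 -size_poly_eq0 sP.
  by rewrite lead_coefE sP.
have root : a%:~R * x ^+ 2 + b%:~R * x + c%:~R = 0.
  move/rootP: Px; rewrite (@horner_coef_wide _ 3) ?size_map_inj_poly ?sP//; last exact: intr_inj.
  by rewrite !big_ord_recl big_ord0 !coef_map /= expr0 expr1 => <-; rewrite /a /b /c; ring.
have [[n n0]|nz] := pselect (exists n, iter n (@gauss_map R) x = 0).
  apply: (rational_question_mark_iter (n := n)) => //.
  by rewrite n0 question_mark0; exact: (rational_int 0).
have {}nz k : iter k (@gauss_map R) x != 0 by apply/eqP => k0; apply: nz; exists k.
have [D0|D0] := eqVneq (b ^+ 2 - 4 * a * c) 0; last first.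
  have [m [k mk]] := gauss_orbit_eventually_periodic x01 nz root D0.
  apply: (rational_question_mark_iter (n := m)) => //.
  by apply: (rational_question_mark_periodic (n := k)) => //; exact: iter_gauss_bounds.
apply: rational_question_mark_rational => //.
have aR : a%:~R != 0 :> R by rewrite intr_eq0.
have xE : 2 * a%:~R * x + b%:~R = 0.
  apply/eqP; rewrite -(sqrf_eq0 (_ + _)) -subr_eq0 subr0 -(mulr0 (4 * a%:~R)) -root.
  have D0' : (b ^+ 2 - 4 * a * c)%:~R = 0 :> R by rewrite D0.
  apply/eqP; transitivity ((b ^+ 2 - 4 * a * c)%:~R + 4 * a%:~R *
    (a%:~R * x ^+ 2 + b%:~R * x + c%:~R)); last by rewrite D0' add0r.
  by ring.
have -> : x = - b%:~R / (2 * a%:~R).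
  have aR2 : 2 * a%:~R != 0 :> R by rewrite mulf_neq0// pnatr_eq0.
  by apply: (mulfI aR2); rewrite [RHS]mulrC divfK//; apply/eqP; rewrite -addr_eq0 xE.
apply: rationalM; first exact/rationalN/rational_int.
by apply: rationalV; apply: rationalM; [exact: (rational_int 2)|exact: rational_int].
Qed.
End RationalValues.

(** * A Vitali estimate for points of fast growth *)

Section Growth.
Context {R : realType}.
Local Open Scope ereal_scope.
Local Notation outer_leb := ((@wlength R idfun)^*%mu).

(** For k > 0: increments over arbitrarily small intervals centred at x are at least h/k. Centred
    intervals are the balls of the covering lemma. *)
Definition steep (F : R -> R) (k : R) : set R :=
  [set x | forall e : R, (0 < e)%R ->
    exists2 h, (0 < h < e)%R & (h <= k * (F (x + h) - F (x - h)))%R].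

Lemma outer_leb_itv (a b : R) : (a <= b)%R -> outer_leb `[a, b]%classic = (b - a)%:E.
Proof.
move=> ab; rewrite -[LHS]/(lebesgue_measure (`[a, b]%classic : set R)).
rewrite lebesgue_measure_itv /= lte_fin; move: ab; rewrite le_eqVlt => /predU1P[->|->].
  by rewrite ltxx subrr.
by rewrite EFinB.
Qed.

Lemma outer_leb_set1 (a : R) : outer_leb [set a] = 0.
Proof. exact: (lebesgue_measure_set1 a). Qed.

Lemma lebesgue_stieltjes_measure_itv (F : cumulative R R) (a b : R) : (a <= b)%R ->
  lebesgue_stieltjes_measure F (`]a, b]%classic : set R) = (F b - F a)%:E.
Proof.
move=> ab; rewrite /lebesgue_stieltjes_measure /measure_extension measurable_mu_extE.
  exact: wlength_itv_bnd.
exact: is_ocitv.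
Qed.

(* Vitali: the balls witnessing steepness can be thinned to a disjoint family
   whose five-fold enlargements cover, and disjoint increments of [F] add up
   to at most its total increment. *)
Lemma outer_leb_steep (F : cumulative R R) (k a b : R) : (0 <= k)%R -> (a <= b)%R ->
  outer_leb (steep F k `&` `]a, b[%classic) <= (10 * k * (F b - F a))%:E.
Proof.
move=> k0 ab; set V := steep F k `&` _.
have hP x : exists h : R, [/\ (0 < h)%R, V x -> (h <= 1)%R &
    V x -> [/\ (a < x - h)%R, (x + h < b)%R &
               (h <= k * (F (x + h) - F (x - h)))%R]].
  (* Off [V] the radius 1 is a placeholder; only balls centred in [V] are selected. *)
  have [|nV] := pselect (V x); last by exists 1%R.
  move=> -[+ /=]; rewrite in_itv /= => st /andP[ax xb].
  (* The covering lemma needs bounded radii, and the balls must stay inside the open interval. *)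
  have e0 : (0 < Num.min 1 (Num.min (x - a) (b - x)))%R by rewrite !lt_min ltr01 !subr_gt0 ax.
  have [h /andP[h0]] := st _ e0; rewrite !lt_min => /and3P[h1 h2 h3] hF.
  by exists h; split=> // [_|_]; [exact: ltW|split => //; lra].
have {hP}[h hP] := choice hP.
have h0 x : (0 < h x)%R by have [] := hP x.
pose B x := ball x (h x).
have radB x : ((radius (B x))%:num = h x)%R by rewrite radius_ball_num// ltW.
have BB x : is_ball (B x) by exact: is_ball_ball.
have B0 x : ((radius (B x))%:num > 0)%R by rewrite radB.
have VB1 x : V x -> ((radius (B x))%:num <= 1)%R by rewrite radB; have [] := hP x.
have [D [/countable_injP[f finj] DV tD cov]] := vitali_lemma_infinite_cover BB B0 VB1.
(* The injection [f] re-indexes the countable family by natural numbers, each [E n] being empty or a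
   single centre. *)
pose E n := D `&` f @^-1` [set n].
have E01 n : E n = set0 \/ exists2 j, D j & E n = [set j].
  have [->|/set0P[j [Dj fj]]] := eqVneq (E n) set0; [by left|right; exists j => //].
  apply/seteqP; split=> [i [Di fi]|_ -> //]; apply: finj; rewrite ?inE//.
  by rewrite (fi : f i = n).
pose A n := \bigcup_(j in E n) closed_ball j (5 * h j)%R.
pose C n := \bigcup_(j in E n) `](j - h j)%R, (j + h j)%R]%classic.
have VA : V `<=` \bigcup_n A n.
  move=> x Vx; have [|j Dj /=] := cov x.
    by exists x => //=; apply: subset_closure; exact: ballxx.
  rewrite /scale_ball BB radB cpoint_ball// closure_ballE => xj.
  by exists (f j) => //; exists j.
have mC n : measurable (C n).
  by rewrite /C; have [->|[j _ ->]] := E01 n; rewrite ?bigcup_set0 ?bigcup_set1.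
(* The enlarged ball has radius 5h, hence length 10h, and steepness bounds h by k times the
   increment. *)
have AC n : outer_leb (A n) <= (10 * k)%:E * lebesgue_stieltjes_measure F (C n).
  rewrite /A /C; have [->|[j Dj ->]] := E01 n.
    by rewrite !bigcup_set0 outer_measure0 mule_ge0// lee_fin mulr_ge0.
  have [_ _ /(_ (DV _ Dj))[_ _ hF]] := hP j; have hj := h0 j.
  rewrite !bigcup_set1 lebesgue_stieltjes_measure_itv; last by lra.
  rewrite -[leLHS]/(lebesgue_measure (closed_ball j (5 * h j)%R)).
  rewrite lebesgue_measure_closed_ball ?mulr_ge0 ?(ltW hj)//.
  by rewrite -EFinM lee_fin -mulr_natr; lra.
have tC : trivIset setT C.
  apply/trivIsetP => i j _ _ ij; apply/seteqP; split => // x [[u [Du fu] xu] [v [Dv fv] xv]].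
  have uv : u = v.
    apply: (tD u v Du Dv); exists x; rewrite /= !closure_ballE !closed_ballE//.
    move: xu xv; rewrite /= !in_itv /= /closed_ball_ /= !ler_norml.
    by move=> /andP[? ?] /andP[? ?]; split; lra.
  by move: ij; rewrite -(fu : f u = i) -(fv : f v = j) uv eqxx.
apply: (@le_trans _ _ (outer_leb (\bigcup_n A n))); first exact: le_outer_measure.
apply: (@le_trans _ _ (\sum_(n <oo) outer_leb (A n))).
  exact: outer_measure_sigma_subadditive.
apply: (@le_trans _ _ (\sum_(n <oo) (10 * k)%:E * lebesgue_stieltjes_measure F (C n))).
  by apply: lee_nneseries => [n _ _|n _]; [exact: outer_measure_ge0|exact: AC].
have mUC : measurable (\bigcup_n C n) by apply: bigcup_measurable => n _; exact: mC.
rewrite nneseriesZl// -measure_semi_bigcup//.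
rewrite [leRHS]EFinM; apply: lee_wpmul2l; first by rewrite lee_fin mulr_ge0.
rewrite -lebesgue_stieltjes_measure_itv//; apply: le_measure; rewrite ?inE//.
move=> x [n _ [j [Dj _]]] /=; rewrite !in_itv /= => /andP[jx xj].
have [_ _ /(_ (DV _ Dj))[hja hjb _]] := hP j.
by apply/andP; split; lra.
Qed.

(** The outer measure is at most the length and, endpoints being null, at most 10k times the
    increment. The smaller of length and increment is at most their geometric mean; [10 * k + 1]
    covers both factors. *)
Lemma outer_leb_steep_segment (F : cumulative R R) (k a b : R) :
  (0 <= k)%R -> (a <= b)%R ->
  outer_leb (steep F k `&` `[a, b]%classic) <=
  ((10 * k + 1) * Num.sqrt ((F b - F a) * (b - a)))%:E.
Proof.
move=> k0 ab.
have Fab : (0 <= F b - F a)%R by rewrite subr_ge0 (cumulative_is_nondecreasing F).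
have ba0 : (0 <= b - a)%R by rewrite subr_ge0.
have le1 : outer_leb (steep F k `&` `[a, b]%classic) <= (b - a)%:E.
  by rewrite -outer_leb_itv//; apply: le_outer_measure; exact: subIsetr.
have le2 : outer_leb (steep F k `&` `[a, b]%classic) <= (10 * k * (F b - F a))%:E.
  have sub : steep F k `&` `[a, b] `<=`
      (steep F k `&` `]a, b[%classic) `|` ([set a] `|` [set b]).
    move=> x [xs /=]; rewrite in_itv /= => /andP[].
    rewrite le_eqVlt => /predU1P[->|ax]; first by right; left.
    rewrite le_eqVlt => /predU1P[->|xb]; first by right; right.
    by left; split => //=; rewrite in_itv /= ax.
  apply: (le_trans (le_outer_measure outer_leb _ _ sub)).
  apply: (le_trans (outer_measureU2 _ _ _)); rewrite -[leRHS]adde0.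
  apply: leeD; first exact: outer_leb_steep.
  apply: (le_trans (outer_measureU2 _ _ _)).
  by rewrite -[leRHS]adde0; apply: leeD; rewrite le_eqVlt; apply/orP; left; apply/eqP;
    exact: outer_leb_set1.
have [h|h] := leP (b - a)%R (F b - F a)%R.
  apply: (le_trans le1); rewrite lee_fin.
  apply: (@le_trans _ _ (Num.sqrt ((F b - F a) * (b - a)))%R).
    by rewrite -[leLHS]ger0_norm// -sqrtr_sqr ler_wsqrtr// expr2 ler_wpM2r.
  by rewrite ler_peMl ?sqrtr_ge0//; lra.
apply: (le_trans le2); rewrite lee_fin.
apply: ler_pM => //; [exact: mulr_ge0|lra|].
by rewrite -[leLHS]ger0_norm// -sqrtr_sqr ler_wsqrtr// expr2 ler_wpM2l// ltW.
Qed.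
End Growth.

(** * Hellinger affinity of the two digit distributions *)

Section Affinity.
Context {R : realType} (t : nat -> R).
Hypothesis t01 : forall j, (1 <= j)%N -> 0 <= t j <= 1.
Hypothesis tdecr : forall j, (1 <= j)%N -> t j.+1 < t j.
Hypothesis t1 : t 1%N = 1.
Implicit Types (r x y : R) (a n N : nat).
Local Notation p := (luroth_width t).

(* The proportion of a continued fraction cylinder occupied by its child of
   digit [a], where [r] is the ratio of the last two convergent denominators. *)
Definition gauss_width r a : R := (1 + r) / ((a%:R + r) * (a.+1%:R + r)).
Local Notation q := gauss_width.

Lemma gauss_width_ge0 r a : 0 <= r -> 0 <= q r a.
Proof. by move=> r0; rewrite /q divr_ge0 ?addr_ge0 ?mulr_ge0 ?addr_ge0. Qed.

(** The sum telescopes: [q r a] is (1 + r) times 1/(a + r) - 1/(a + 1 + r). *)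
Lemma sum_gauss_width r N : 0 <= r ->
  \sum_(a < N) q r a.+1 = 1 - (1 + r) / (N.+1%:R + r).
Proof.
move=> r0; elim: N => [|N IH].
  by rewrite big_ord0 divff ?subrr// gt_eqF//; lra.
have N0 : 0 <= N%:R :> R by exact: ler0n.
rewrite big_ord_recr /= IH /q -[N.+2%:R]natr1 -[N.+1%:R]natr1.
by field; apply/andP; split; rewrite gt_eqF//; lra.
Qed.

Lemma sum_gauss_width_le1 r N : 0 <= r -> \sum_(a < N) q r a.+1 <= 1.
Proof.
move=> r0; rewrite sum_gauss_width// gerBl divr_ge0// addr_ge0//.
Qed.

Lemma sum_luroth_width N : \sum_(a < N) p a.+1 = 1 - t N.+1.
Proof.
elim: N => [|N IH]; first by rewrite big_ord0 t1 subrr.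
by rewrite big_ord_recr /= IH /p; ring.
Qed.

Lemma sum_luroth_width_le1 N : \sum_(a < N) p a.+1 <= 1.
Proof. by rewrite sum_luroth_width gerBl ltW// t_gt0. Qed.

Lemma gauss_width_le1 r a : 0 <= r -> (1 <= a)%N -> q r a <= 1.
Proof.
case: a => // a r0 _; apply: le_trans (sum_gauss_width_le1 a.+1 r0).
by rewrite big_ord_recr /= lerDr sumr_ge0// => i _; exact: gauss_width_ge0.
Qed.

Lemma luroth_width_le1 a : (1 <= a)%N -> p a <= 1.
Proof.
move=> /(luroth_width_le t01 tdecr t1) h; apply: le_trans h _.
by have /andP[_ /ltW] := luroth_ratio_bounds t01 tdecr t1.
Qed.

(** With u and v the square roots, the defect in the mean inequality is (u - v)^2 / 2, while (x -
    y)^2 = (u - v)^2 (u + v)^2 <= 4 (u - v)^2. *)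
Lemma sqrtM_le_mean x y : 0 <= x <= 1 -> 0 <= y <= 1 ->
  Num.sqrt (x * y) <= (x + y) / 2 - (x - y) ^+ 2 / 8.
Proof.
move=> /andP[x0 x1] /andP[y0 y1]; rewrite sqrtrM//.
rewrite -{2 3}(sqr_sqrtr x0) -{2 3}(sqr_sqrtr y0).
have s0 := sqrtr_ge0 x; have s0' := sqrtr_ge0 y.
have s1 : Num.sqrt x <= 1 by rewrite -sqrtr1 ler_wsqrtr.
have s1' : Num.sqrt y <= 1 by rewrite -sqrtr1 ler_wsqrtr.
move: (Num.sqrt x) (Num.sqrt y) s0 s0' s1 s1' => u v u0 v0 u1 v1.
rewrite -subr_ge0.
have -> : (u ^+ 2 + v ^+ 2) / 2 - (u ^+ 2 - v ^+ 2) ^+ 2 / 8 - u * v =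
    (u - v) ^+ 2 * (4 - (u + v) ^+ 2) / 8 by field.
rewrite divr_ge0// mulr_ge0 ?sqr_ge0//; nra.
Qed.

(* Bounds the Hellinger affinity of the distributions [p] and [q r]; the
   correction to 1 comes from the digit 1 alone. *)
Definition affinity_bound r : R := 1 - (p 1%N - (2 + r)^-1) ^+ 2 / 8.
Local Notation g := affinity_bound.

Lemma gauss_width1 r : 0 <= r -> q r 1%N = (2 + r)^-1.
Proof. by move=> r0; rewrite /q; field; apply/andP; split; rewrite gt_eqF//; lra. Qed.

Lemma affinity_bound_bounds r : 0 <= r -> 0 <= g r <= 1.
Proof.
move=> r0; have := luroth_width_le1 (leqnn 1); have := luroth_width_gt0 tdecr (leqnn 1).
have := gauss_width_le1 r0 (leqnn 1); have := gauss_width_ge0 1 r0.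
rewrite gauss_width1// /g => q0 q1 p0 p1.
have : -1 <= p 1%N - (2 + r)^-1 <= 1 by apply/andP; split; lra.
by move: (_ - (2 + r)^-1) => z /andP[? ?]; apply/andP; split; nra.
Qed.

Lemma sqrt_widths_le r a : 0 <= r ->
  Num.sqrt (p a.+1 * q r a.+1) <= (p a.+1 + q r a.+1) / 2 - (p a.+1 - q r a.+1) ^+ 2 / 8.
Proof.
move=> r0; apply: sqrtM_le_mean; apply/andP; split.
- by rewrite ltW// luroth_width_gt0.
- exact: luroth_width_le1.
- exact: gauss_width_ge0.
- exact: gauss_width_le1.
Qed.

Lemma sqrt_widths_le_mean r a : 0 <= r ->
  Num.sqrt (p a.+1 * q r a.+1) <= (p a.+1 + q r a.+1) / 2.
Proof.
move=> r0; apply: le_trans (sqrt_widths_le a r0) _.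
by rewrite gerBl divr_ge0// sqr_ge0.
Qed.

(** The sharpened mean inequality is spent on digit 1 and the plain one on the rest, both
    distributions having mass at most 1. The factor 1 matches the weights in
    [outer_leb_cylinder_step]. *)
Lemma affinity1 r N : 0 <= r ->
  \sum_(a < N) 1 * Num.sqrt (p a.+1 * q r a.+1) <= g r.
Proof.
move=> r0; case: N => [|N]; first by rewrite big_ord0; case/andP: (affinity_bound_bounds r0).
have h1 := sum_luroth_width_le1 N.+1; have h2 := sum_gauss_width_le1 N.+1 r0.
move: h1 h2; rewrite !big_ord_recl /= => h1 h2.
have h3 := sqrt_widths_le 0 r0.
have h4 : \sum_(i < N) 1 * Num.sqrt (p i.+2 * q r i.+2) <=
    (\sum_(i < N) p i.+2 + \sum_(i < N) q r i.+2) / 2.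
  rewrite -big_split mulr_suml; apply: ler_sum => i _; rewrite mul1r.
  exact: sqrt_widths_le_mean.
rewrite mul1r; apply: le_trans (lerD h3 h4) _.
by rewrite /g -gauss_width1//; lra.
Qed.

(* The gap 1/70 between [p 1] and [(2 + r')^-1] in [affinity_bound_gap] costs
   (1/70)^2 / 8 >= 1/40000, on a digit of mean weight at least 1/40. *)
Definition affinity_rate : R := 1 - (200^-1 / 200) / 40.

Lemma affinity_rate_bounds : 0 < affinity_rate < 1.
Proof. by rewrite /affinity_rate; lra. Qed.

(* [p 1] cannot be close both to the values of [(2 + r')^-1] after a digit 1
   and after a digit 3, these being in [1/3, 2/5] and [3/7, 4/9]. *)
Lemma affinity_bound_gap r : 0 <= r <= 1 ->
  g (1 + r)^-1 <= 1 - (200^-1 / 200) \/ g (3 + r)^-1 <= 1 - (200^-1 / 200).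
Proof.
move=> /andP[r0 r1].
have h1 : (2 + (1 + r)^-1)^-1 <= 2 / 5.
  have -> : (2 + (1 + r)^-1)^-1 = (1 + r) / (3 + 2 * r).
    by field; apply/andP; split; rewrite gt_eqF//; lra.
  by rewrite ler_pdivrMr; lra.
have h2 : 3 / 7 <= (2 + (3 + r)^-1)^-1.
  have -> : (2 + (3 + r)^-1)^-1 = (3 + r) / (7 + 2 * r).
    by field; apply/andP; split; rewrite gt_eqF//; lra.
  by rewrite ler_pdivlMr; lra.
rewrite /g; move: (p 1%N) ((2 + (1 + r)^-1)^-1) ((2 + (3 + r)^-1)^-1) h1 h2 => u v w h1 h2.
have [h|h] := leP u (29 / 70); [right|left].
- have : 1 / 70 <= w - u by lra.
  by move: (w - u) => z; nra.
- have : 1 / 70 <= u - v by lra.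
  by move: (u - v) => z; nra.
Qed.

(** After a digit a the denominator ratio r becomes (a + r)^-1, so the weights bound the affinity
    one generation further down; digit 1 or digit 3 supplies the loss. *)
Lemma affinity2 r N : 0 <= r <= 1 ->
  \sum_(a < N) g (a.+1%:R + r)^-1 * Num.sqrt (p a.+1 * q r a.+1) <= affinity_rate.
Proof.
move=> /andP[r0 r1].
have rr a : 0 <= (a.+1%:R + r)^-1 by rewrite invr_ge0 addr_ge0.
have g01 a := affinity_bound_bounds (rr a).
have term a : g (a.+1%:R + r)^-1 * Num.sqrt (p a.+1 * q r a.+1) <=
    g (a.+1%:R + r)^-1 * ((p a.+1 + q r a.+1) / 2).
  by rewrite ler_wpM2l ?sqrt_widths_le_mean//; case/andP: (g01 a).
(* Three nonnegative terms are added so that digits 1, 2 and 3 can be split off for every N. *)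
apply: (@le_trans _ _ (\sum_(a < N.+3) g (a.+1%:R + r)^-1 * ((p a.+1 + q r a.+1) / 2))).
  have pq0 a : 0 <= g (a.+1%:R + r)^-1 * ((p a.+1 + q r a.+1) / 2).
    have pp := luroth_width_gt0 tdecr (ltn0Sn a); have qq := gauss_width_ge0 a.+1 r0.
    by apply: mulr_ge0; [case/andP: (g01 a)|lra].
  rewrite 3!big_ord_recr /= -2!addrA ler_wpDr ?addr_ge0//.
  by apply: ler_sum => i _; exact: term.
have h1 := sum_luroth_width_le1 N.+3; have h2 := sum_gauss_width_le1 N.+3 r0.
move: h1 h2; rewrite !big_ord_recl /= => h1 h2.
have h4 : \sum_(i < N) g (i.+4%:R + r)^-1 * ((p i.+4 + q r i.+4) / 2) <=
    (\sum_(i < N) p i.+4 + \sum_(i < N) q r i.+4) / 2.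
  rewrite -big_split mulr_suml; apply: ler_sum => i _.
  rewrite ler_piMl//; last by case/andP: (g01 i.+3).
  have := luroth_width_gt0 tdecr (ltn0Sn i.+3); have := gauss_width_ge0 i.+4 r0; lra.
(* Half of 1/20 is the mean weight 1/40 in [affinity_rate]. *)
have q1 : 1 / 20 <= q r 1%N by rewrite /q ler_pdivlMr; nra.
have q3 : 1 / 20 <= q r 3%N by rewrite /q ler_pdivlMr; nra.
have p1 := luroth_width_gt0 tdecr (leqnn 1); have p2 := @luroth_width_gt0 _ t tdecr 2 isT.
have p3 := @luroth_width_gt0 _ t tdecr 3 isT; have q2 := gauss_width_ge0 2 r0.
have gap := affinity_bound_gap (introT andP (conj r0 r1)).
have /andP[_ g1] := g01 0%N; have /andP[_ g2] := g01 1%N; have /andP[_ g3] := g01 2%N.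
move: h1 h2 h4 q1 q3 p1 p2 p3 q2 gap g1 g2 g3; rewrite /affinity_rate.
move: (p 1%N) (p 2%N) (p 3%N) (q r 1%N) (q r 2%N) (q r 3%N) => p1 p2 p3 q1 q2 q3.
move: (g (1%:R + r)^-1) (g (2%:R + r)^-1) (g (3%:R + r)^-1) => g1 g2 g3.
move: (\sum_(i < N) p i.+4) (\sum_(i < N) q r i.+4) (\sum_(i < N) g _ * _) => P S T.
move=> h1 h2 h4 hq1 hq3 hp1 hp2 hp3 hq2 gap hg1 hg2 hg3.
have e2 : g2 * ((p2 + q2) / 2) <= (p2 + q2) / 2 by rewrite ler_piMl//; lra.
have [gg|gg] := gap.
- have e1 : g1 * ((p1 + q1) / 2) <= (1 - (200^-1 / 200)) * ((p1 + q1) / 2).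
    by rewrite ler_wpM2r//; lra.
  have e3 : g3 * ((p3 + q3) / 2) <= (p3 + q3) / 2 by rewrite ler_piMl//; lra.
  lra.
- have e1 : g1 * ((p1 + q1) / 2) <= (p1 + q1) / 2 by rewrite ler_piMl//; lra.
  have e3 : g3 * ((p3 + q3) / 2) <= (1 - (200^-1 / 200)) * ((p3 + q3) / 2).
    by rewrite ler_wpM2r//; lra.
  lra.
Qed.
End Affinity.

(** * Geometric decay over continued fraction cylinders *)

Section Cylinders.
Context {R : realType} (t : nat -> R).
Hypothesis t01 : forall j, (1 <= j)%N -> 0 <= t j <= 1.
Hypothesis tdecr : forall j, (1 <= j)%N -> t j.+1 < t j.
Hypothesis t1 : t 1%N = 1.
Context (F : cumulative R R) (k : R).
Hypothesis FQ : forall x, 0 <= x <= 1 -> F x = question_mark t x.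
Hypothesis k_ge0 : 0 <= k.
Implicit Types (x y z w kap b c : R) (a n : nat).
Local Notation p := (luroth_width t).
Local Notation Q := (question_mark t).
Local Notation outer_leb := ((@wlength R idfun)^*%mu).

(** For a continued fraction cylinder, b/c and b'/c' are the last two convergents, starting from 0/1
    and the formal 1/0. *)
Definition cylinder b b' c c' : set R :=
  [set (b + b' * y) / (c + c' * y) | y in `[0, 1]%classic].

Definition cylinder_length b b' c c' : R := `|b' * c - b * c'| / (c * (c + c')).

(* [question_mark t] is affinely conjugate to itself on the cylinder, with
   image of length [`|kap|]. *)
Definition self_affine b b' c c' w kap := forall y, 0 <= y <= 1 ->
  0 <= (b + b' * y) / (c + c' * y) <= 1 /\
  Q ((b + b' * y) / (c + c' * y)) = w + kap * Q y.

(** The child of digit a comes from substituting y = 1/(a + z), to which the functional equation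
    applies. *)
Lemma self_affine_child a b b' c c' w kap : (1 <= a)%N -> 0 < c -> 0 <= c' ->
  self_affine b b' c c' w kap ->
  self_affine (b * a%:R + b') b (c * a%:R + c') c (w + kap * t a) (- (kap * p a)).
Proof.
move=> a1 c0 c'0 aff z /andP[z0 z1].
have a1R : 1 <= a%:R :> R by rewrite ler1n.
have y01 : 0 <= (a%:R + z)^-1 <= 1.
  by apply/andP; split; [rewrite invr_ge0; lra|rewrite invf_le1; lra].
have ca : 0 < c * a%:R by rewrite mulr_gt0//; lra.
have cz : 0 <= c * z by rewrite mulr_ge0// ltW.
have -> : (b * a%:R + b' + b * z) / (c * a%:R + c' + c * z) =
   (b + b' * (a%:R + z)^-1) / (c + c' * (a%:R + z)^-1).
  by field; rewrite !gt_eqF//=; lra.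
have [h ->] := aff _ y01; split=> //.
by rewrite question_mark_cons ?z0//; ring.
Qed.

(** The determinant only changes sign, so the proportion depends on the denominators alone. *)
Lemma cylinder_length_child a b b' c c' : 0 < c -> 0 <= c' ->
  cylinder_length (b * a.+1%:R + b') b (c * a.+1%:R + c') c =
  cylinder_length b b' c c' * gauss_width (c' / c) a.+1.
Proof.
move=> c0 c'0; rewrite /cylinder_length /gauss_width.
have -> : b * (c * a.+1%:R + c') - (b * a.+1%:R + b') * c = - (b' * c - b * c') by ring.
rewrite normrN -[a.+2%:R]natr1 -[a.+1%:R]natr1; have a0 : 0 <= a%:R :> R by [].
have ca : 0 <= c * a%:R by rewrite mulr_ge0// ltW.
field; rewrite !gt_eqF//; nra.
Qed.

(** The differences to the endpoints at y = 0 and y = 1 are nonnegative multiples of the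
    determinant; its sign decides their order. *)
Lemma cylinder_segment b b' c c' : 0 < c -> 0 <= c' ->
  let u := b / c in let v := (b + b') / (c + c') in
  cylinder b b' c c' `<=` `[Num.min u v, Num.max u v]%classic /\
  `|v - u| = cylinder_length b b' c c'.
Proof.
move=> c0 c'0 u v; split; last first.
  have -> : v - u = (b' * c - b * c') / (c * (c + c')).
    by rewrite /v /u; field; rewrite !gt_eqF//; lra.
  by rewrite normrM (@ger0_norm _ (_ * _)^-1)// invr_ge0 mulr_ge0//; lra.
move=> x [y /=]; rewrite in_itv /= => /andP[y0 y1] <-.
have cy : 0 < c + c' * y by rewrite ltr_pwDl// mulr_ge0.
have h1 : (b + b' * y) / (c + c' * y) - u = (b' * c - b * c') * (y / (c * (c + c' * y))).
  by rewrite /u; field; rewrite !gt_eqF//; lra.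
have h2 : v - (b + b' * y) / (c + c' * y) =
    (b' * c - b * c') * ((1 - y) / ((c + c') * (c + c' * y))).
  by rewrite /v; field; rewrite !gt_eqF//; lra.
have p1 : 0 <= y / (c * (c + c' * y)) by rewrite divr_ge0// mulr_ge0// ltW.
have p2 : 0 <= (1 - y) / ((c + c') * (c + c' * y)).
  by rewrite divr_ge0 ?subr_ge0// mulr_ge0 ?ltW// ltr_pwDl.
rewrite in_itv /= ge_min le_max.
have [d0|d0] := leP 0 (b' * c - b * c').
- have := mulr_ge0 d0 p1; have := mulr_ge0 d0 p2; rewrite -h1 -h2 !subr_ge0 => -> ->.
  by rewrite orbT.
- have := mulr_le0_ge0 (ltW d0) p1; have := mulr_le0_ge0 (ltW d0) p2.
  by rewrite -h1 -h2 !subr_le0 => -> ->; rewrite orbT.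
Qed.

Lemma outer_leb_cylinder0 b b' c c' w kap : 0 < c -> 0 <= c' ->
  self_affine b b' c c' w kap ->
  (outer_leb (steep F k `&` cylinder b b' c c') <=
   ((10 * k + 1) * Num.sqrt (`|kap| * cylinder_length b b' c c'))%:E)%E.
Proof.
move=> c0 c'0 aff; have [sub <-] := cylinder_segment b b' c0 c'0.
have [] := aff 0; first by rewrite lexx ler01.
have [] := aff 1; first by rewrite ler01 lexx.
rewrite !mulr1 !mulr0 !addr0 question_mark0 (question_mark1 t01 tdecr t1) mulr0 mulr1 addr0.
set u := b / c in sub *; set v := (b + b') / (c + c') in sub *.
move=> v01 Qv u01 Qu.
have Fuv : F v - F u = kap by rewrite !FQ// Qv Qu addrAC subrr add0r.
apply: (@le_trans _ _ (outer_leb (steep F k `&` `[Num.min u v, Num.max u v]%classic))).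
  by apply: le_outer_measure; apply: setIS.
have [uv|vu] := leP u v.
- have -> : `|kap| = F v - F u.
    by rewrite -Fuv ger0_norm// subr_ge0 (cumulative_is_nondecreasing F).
  by rewrite ger0_norm ?subr_ge0//; exact: (outer_leb_steep_segment F k_ge0 uv).
- have -> : `|kap| = F u - F v.
    by rewrite -Fuv distrC ger0_norm// subr_ge0 (cumulative_is_nondecreasing F) ?ltW.
  rewrite distrC ger0_norm ?subr_ge0 ?(ltW vu)//.
  exact: (outer_leb_steep_segment F k_ge0 (ltW vu)).
Qed.

(** The parameter y = 0 has no first digit and contributes the endpoint b/c. *)
Lemma cylinder_subset b b' c c' : 0 < c -> 0 <= c' ->
  cylinder b b' c c' `<=` [set b / c] `|`
    \bigcup_a cylinder (b * a.+1%:R + b') b (c * a.+1%:R + c') c.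
Proof.
move=> c0 c'0 x [y /=]; rewrite in_itv /= => /andP[y0 y1] <-.
move: y0; rewrite le_eqVlt => /predU1P[<-|y0]; first by left; rewrite !mulr0 !addr0.
right; have y01 : 0 < y <= 1 by rewrite y0.
have [yE d1 /andP[g0 g1]] := gauss_mapP y01.
exists (gauss_digit y).-1 => //; rewrite prednK//; exists (gauss_map y).
  by rewrite /= in_itv /= g0 ltW.
have dE : (gauss_digit y)%:R = y^-1 - gauss_map y by rewrite yE addrK.
have -> : b * (gauss_digit y)%:R + b' + b * gauss_map y = (b + b' * y) / y.
  by rewrite dE; field; rewrite gt_eqF.
have -> : c * (gauss_digit y)%:R + c' + c * gauss_map y = (c + c' * y) / y.
  by rewrite dE; field; rewrite gt_eqF.
have cy : 0 <= c' * y by rewrite mulr_ge0// ltW.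
field; rewrite !gt_eqF//; lra.
Qed.

(** The square root for a child is that of the parent times [Num.sqrt (p a.+1 * gauss_width (c' / c)
    a.+1)], so subadditivity leaves a weighted affinity. The weights [e] carry the gain of the next
    generation. *)
Lemma outer_leb_cylinder_step (S : set R) b b' c c' kap (L B : R) (e : nat -> R) :
  0 < c -> 0 <= c' -> 0 <= L ->
  (forall a, outer_leb (S `&` cylinder (b * a.+1%:R + b') b (c * a.+1%:R + c') c) <=
    (L * (e a * Num.sqrt (`|kap * p a.+1| *
      cylinder_length (b * a.+1%:R + b') b (c * a.+1%:R + c') c)))%:E)%E ->
  (forall N, \sum_(a < N) e a * Num.sqrt (p a.+1 * gauss_width (c' / c) a.+1) <= B) ->
  (outer_leb (S `&` cylinder b b' c c') <=
    (L * (B * Num.sqrt (`|kap| * cylinder_length b b' c c')))%:E)%E.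
Proof.
move=> c0 c'0 L0 child sumB.
pose A a := S `&` cylinder (b * a.+1%:R + b') b (c * a.+1%:R + c') c.
have len0 : 0 <= cylinder_length b b' c c'.
  by rewrite divr_ge0// mulr_ge0//; lra.
set s := Num.sqrt (`|kap| * _).
have sE a : Num.sqrt (`|kap * p a.+1| *
      cylinder_length (b * a.+1%:R + b') b (c * a.+1%:R + c') c) =
    s * Num.sqrt (p a.+1 * gauss_width (c' / c) a.+1).
  rewrite cylinder_length_child// normrM (gtr0_norm (luroth_width_gt0 tdecr _))//.
  by rewrite mulrACA sqrtrM// mulr_ge0.
have sub : S `&` cylinder b b' c c' `<=` [set b / c] `|` \bigcup_a A a.
  move=> x [Sx /(cylinder_subset c0 c'0)[->|[a _ xa]]]; first by left.
  by right; exists a.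
apply: (@le_trans _ _ (outer_leb ([set (b / c)%R] `|` \bigcup_a A a))).
  exact: le_outer_measure.
apply: (@le_trans _ _ (outer_leb [set (b / c)%R] + outer_leb (\bigcup_a A a))%E).
  exact: outer_measureU2.
rewrite outer_leb_set1 add0e.
apply: (@le_trans _ _ (\sum_(a <oo) outer_leb (A a))%E).
  exact: outer_measure_sigma_subadditive.
apply: lime_le.
  by apply: is_cvg_nneseries => n _ _; exact: outer_measure_ge0.
near=> N.
apply: (@le_trans _ _ (\sum_(0 <= a < N)
   (L * s * (e a * Num.sqrt (p a.+1 * gauss_width (c' / c) a.+1)))%:E)%E).
  apply: lee_sum => a _; apply: le_trans (child a) _.
  by rewrite sE lee_fin le_eqVlt; apply/orP; left; apply/eqP; ring.
rewrite sumEFin lee_fin -mulr_sumr big_mkord mulrAC -mulrA.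
rewrite ler_wpM2l// ler_wpM2r ?sqrtr_ge0//.
Unshelve. all: by end_near. Qed.

(** Each induction step descends two generations: the inner one yields [affinity_bound] by
    [affinity1], and [affinity2] sums these as weights of the outer one. *)
Lemma outer_leb_cylinder n b b' c c' w kap : 0 < c -> 0 <= c' <= c ->
  self_affine b b' c c' w kap ->
  (outer_leb (steep F k `&` cylinder b b' c c') <=
   ((10 * k + 1) * affinity_rate ^+ n *
     Num.sqrt (`|kap| * cylinder_length b b' c c'))%:E)%E.
Proof.
have /andP[th0 th1] := @affinity_rate_bounds R.
elim: n b b' c c' w kap => [|n IH] b b' c c' w kap c0 /andP[c'0 c'c] aff.
  by rewrite expr0 mulr1; exact: outer_leb_cylinder0 aff.
have K0 : 0 <= (10 * k + 1) * affinity_rate ^+ n.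
  by rewrite mulr_ge0 ?exprn_ge0 ?(ltW th0)// addr_ge0// mulr_ge0.
have r0 : 0 <= c' / c by rewrite divr_ge0// ltW.
have r1 : c' / c <= 1 by rewrite ler_pdivrMr// mul1r.
have cpos a (d d' : R) : 0 < d -> 0 <= d' -> 0 < d * a.+1%:R + d' /\ d <= d * a.+1%:R + d'.
  move=> d0 d'0; have : d <= d * a.+1%:R by rewrite ler_peMr ?ler1n// ltW.
  by lra.
rewrite exprSr mulrA -[X in (X)%:E]mulrA.
apply: (outer_leb_cylinder_step (e := fun a => affinity_bound t (a.+1%:R + c' / c)^-1)) => //;
  last first.
  by move=> N; apply: affinity2 => //; rewrite r0.
move=> a; have [ca0 ca1] := cpos a c c' c0 c'0.
have affa := self_affine_child (ltn0Sn a) c0 c'0 aff.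
rewrite -[`|kap * _|]normrN.
have -> : (a.+1%:R + c' / c)^-1 = c / (c * a.+1%:R + c').
  have ? : 0 < c * a.+1%:R by rewrite mulr_gt0.
  field; rewrite !gt_eqF//=; lra.
apply: (outer_leb_cylinder_step (e := fun=> 1)) => //; first exact: ltW; last first.
  by move=> N; apply: affinity1 => //; rewrite divr_ge0 ?ltW.
move=> d; rewrite mul1r.
have [cd0 cd1] := cpos d _ c ca0 (ltW c0).
have affd := self_affine_child (ltn0Sn d) ca0 (ltW c0) affa.
rewrite -[`|_ * p _|]normrN; apply: IH affd => //.
by rewrite (ltW ca0).
Qed.

Lemma outer_leb_steep_unit : outer_leb (steep F k `&` `[0, 1]%classic) = 0%E.
Proof.
have /andP[th0 th1] := @affinity_rate_bounds R.
have aff : self_affine 0 1 1 0 0 1.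
  by move=> y y01; rewrite !add0r !mul0r !mul1r addr0 divr1.
have cyl : cylinder 0 1 1 0 = `[0, 1]%classic.
  rewrite /cylinder -[RHS]image_id; apply: eq_imagel => y _.
  by rewrite add0r mul1r mul0r addr0 divr1.
have bound n := outer_leb_cylinder n ltr01 (introT andP (conj (lexx 0) ler01)) aff.
apply/eqP; rewrite eq_le outer_measure_ge0 andbT.
have h1 : `|affinity_rate : R| < 1 by rewrite ger0_norm// ltW.
have /cvgr0_norm_lt lim0 := cvg_geometric (10 * k + 1) h1.
apply/lee_addgt0Pr => eps eps0; rewrite add0e.
have [n _ /(_ n (leqnn n)) hn] := lim0 _ eps0.
have := bound n; rewrite cyl => /le_trans; apply; rewrite lee_fin.
have -> : cylinder_length 0 1 1 0 = 1.
  by rewrite /cylinder_length mul0r subr0 !mul1r addr0 normr1 divr1.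
rewrite normr1 mulr1 sqrtr1 mulr1.
by apply: le_trans (ltW hn); exact: ler_norm.
Qed.
End Cylinders.

(** * From null steep sets to a zero derivative almost everywhere *)

Section Singularity.
Context {R : realType} (t : nat -> R).
Hypothesis t01 : forall j, (1 <= j)%N -> 0 <= t j <= 1.
Hypothesis tdecr : forall j, (1 <= j)%N -> t j.+1 < t j.
Hypothesis t1 : t 1%N = 1.
Hypothesis tlim : t j @[j --> \oo] --> 0.
Implicit Types (x y z : R) (n : nat).
Local Notation Q := (question_mark t).

(** Composing with this retraction extends [Q] from [0, 1] to a continuous monotone function on the
    line, as [cumulative] requires. *)
Definition clamp01 x : R := Num.max 0 (Num.min 1 x).

Lemma clamp01_bounds x : 0 <= clamp01 x <= 1.
Proof. by rewrite /clamp01 le_max lexx ge_max ler01 ge_min lexx. Qed.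

Lemma clamp01_id x : 0 <= x <= 1 -> clamp01 x = x.
Proof. by move=> /andP[x0 x1]; rewrite /clamp01 min_r// max_r. Qed.

Lemma clamp01_homo : {homo clamp01 : x y / x <= y}.
Proof.
move=> x y xy; rewrite /clamp01 ge_max !le_max lexx /=; apply/orP; right.
by rewrite le_min !ge_min lexx /= xy orbT.
Qed.

Lemma clamp01_contraction x y : `|clamp01 x - clamp01 y| <= `|x - y|.
Proof.
wlog xy : x y / x <= y.
  by move=> wlg; case: (leP x y) => [|/ltW] xy; [|rewrite distrC [leRHS]distrC]; exact: wlg.
rewrite distrC [leRHS]distrC !ger0_norm ?subr_ge0//; last exact: clamp01_homo.
rewrite /clamp01; case: (leP 1 x) => ?; case: (leP 1 y) => ?;
  rewrite ?(max_r ler01); case: (leP 0 x) => ?; case: (leP 0 y) => ?; lra.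
Qed.

Lemma clamp01_continuous : continuous clamp01.
Proof.
move=> x; apply/cvgrPdist_lt => e e0; near=> z.
apply: le_lt_trans (clamp01_contraction x z) _.
by near: z; exact: cvgr_dist_lt.
Unshelve. all: by end_near. Qed.

Lemma question_mark_clamp01_homo : {homo Q \o clamp01 : x y / x <= y}.
Proof.
move=> x y /clamp01_homo xy /=.
by rewrite question_mark_mono// in_itv /= clamp01_bounds.
Qed.

Lemma question_mark_clamp01_continuous : continuous (Q \o clamp01).
Proof.
move=> x; have /subspace_continuousP Qc := question_mark_continuous t01 tdecr t1 tlim.
have cI z : `[0, 1]%classic (clamp01 z) by rewrite /= in_itv /= clamp01_bounds.
have : clamp01 z @[z --> x] --> within `[0, 1]%classic (nbhs (clamp01 x)).
  move=> S nS.
  have nS' : nbhs x (clamp01 @^-1` [set z | `[0, 1]%classic z -> S z]).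
    exact: clamp01_continuous nS.
  by apply: filterS nS' => z /(_ (cI z)).
by move/cvg_comp; apply; exact: Qc.
Qed.

(** By monotonicity the increment between x and x + h is at most the one over the centred interval
    of radius |h|, which for small h is below |h|/(k + 1). *)
Lemma derivable0_not_steep (F : cumulative R R) x :
  (forall k : nat, ~ steep F k.+1%:R x) ->
  h^-1 *: (F (h *: 1 + x) - F x) @[h --> 0^'] --> (0 : R).
Proof.
move=> nst; apply/cvgrPdist_le => e e0.
have [k ke] : exists k : nat, k.+1%:R^-1 < e.
  have [n _ /(_ n (leqnn n)) ne] := near_infty_natSinv_lt (PosNum e0); by exists n.
have k0 : 0 < k.+1%:R :> R by rewrite ltr0n.
have /existsNP[d /not_implyP[d0 /forall2NP nh]] := nst k.
near=> h.
have h0 : h != 0 by near: h; exact: nbhs_dnbhs_neq.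
have hd : `|h| < d by near: h; apply: dnbhs0_lt.
have hp : 0 < `|h| by rewrite normr_gt0.
have /ltW incr : k.+1%:R * (F (x + `|h|) - F (x - `|h|)) < `|h|.
  by have [|/negP] := nh `|h|; rewrite ?hp ?hd// -ltNge.
rewrite sub0r normrN normrZ normfV ler_pdivrMl// [h *: 1]mulr1 mulrC.
have nd := @cumulative_is_nondecreasing _ _ _ F.
apply: (@le_trans _ _ (F (x + `|h|) - F (x - `|h|))).
  have lo : F (x - `|h|) <= F (h + x).
    by apply: nd; rewrite addrC lerD2r lerNl -normrN ler_norm.
  have hi : F (h + x) <= F (x + `|h|) by apply: nd; rewrite addrC lerD2l ler_norm.
  have lo' : F (x - `|h|) <= F x by apply: nd; rewrite gerBl.
  have hi' : F x <= F (x + `|h|) by apply: nd; rewrite lerDl.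
  by rewrite ler_norml; apply/andP; split; lra.
apply: (@le_trans _ _ (k.+1%:R^-1 * `|h|)).
  by rewrite ler_pdivlMl.
by rewrite ler_wpM2r// ltW.
Unshelve. all: by end_near. Qed.

Lemma question_mark_singular :
  {ae (@lebesgue_measure R), forall x : R, 0 <= x <= 1 ->
    derivable Q x 1 /\ Q^`()%classic x = 0}.
Proof.
pose F : R -> R := Q \o clamp01.
have Frc : right_continuous F.
  by apply: right_continuousW; exact: question_mark_clamp01_continuous.
pose cF := isCumulative.Build R _ R F question_mark_clamp01_homo Frc.
pose G : cumulative R R := HB.pack F cF.
have GQ x : 0 <= x <= 1 -> G x = Q x by move=> x01; rewrite /= /F /= clamp01_id.
(* The endpoints are discarded because the extension agrees with [Q] only on [0, 1], while the
   derivative is two-sided. *)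
pose N := [set (0 : R)] `|` ([set (1 : R)] `|`
  \bigcup_k (steep G k.+1%:R `&` `[0, 1]%classic)).
have N0 : (@lebesgue_measure R).-negligible N.
  apply: negligibleU; first by apply/negligible_outer_measure; exact: outer_leb_set1.
  apply: negligibleU; first by apply/negligible_outer_measure; exact: outer_leb_set1.
  apply: negligible_bigcup => k; apply/negligible_outer_measure.
  exact: (outer_leb_steep_unit t01 tdecr t1 GQ (ler0n R k.+1)).
apply: negligibleS N0 => x /= /not_implyP[x01]; apply: contra_notP => Nx.
have x0 : x != 0 by apply/eqP => x0; apply: Nx; left.
have x1 : x != 1 by apply/eqP => x1; apply: Nx; right; left.
have nst k : ~ steep G k.+1%:R x.
  by move=> sx; apply: Nx; right; right; exists k => //; split.
have x01' : 0 < x < 1 by case/andP: x01 => ? ?; rewrite lt0r x0 lt_neqAle x1; apply/and3P.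
have cvgQ : h^-1 *: (Q (h *: 1 + x) - Q x) @[h --> 0^'] --> (0 : R).
  apply: cvg_trans (derivable0_not_steep nst); apply: near_eq_cvg.
  have /andP[x0' x1'] := x01'.
  near=> h.
  have h1 : `|h| < x by near: h; exact: dnbhs0_lt.
  have h2 : `|h| < 1 - x by near: h; apply: dnbhs0_lt; rewrite subr_gt0.
  have [] := (ltr_normlP _ _ h1); have [] := (ltr_normlP _ _ h2) => *.
  by rewrite !GQ// [h *: 1]mulr1; apply/andP; split; lra.
split; first by apply/cvg_ex; exists 0.
by rewrite derive1E; apply: cvg_lim.
Unshelve. all: by end_near. Qed.
End Singularity.

Theorem theorem2 (R : realType) (t : nat -> R)
    (t01 : forall j, (1 <= j)%N -> 0 <= t j <= 1)
    (tdecr : forall j, (1 <= j)%N -> t j.+1 < t j)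
    (t1 : t 1%N = 1)
    (tlim : t j @[j --> \oo] --> 0) :
  [/\ {in `[0, 1] &, {homo question_mark t : x y / x < y}} /\
      homeomorphism_on (`[0, 1] : set R) (`[0, 1] : set R) (question_mark t),
      {ae (@lebesgue_measure R), forall x : R, 0 <= x <= 1 ->
        derivable (question_mark t) x 1 /\ (question_mark t)^`()%classic x = 0},
      {in `[0, 1], luroth_map t \o question_mark t =1
                   question_mark t \o @gauss_map R} &
      (forall j, (1 <= j)%N -> rational (t j)) ->
      forall x : R, 0 <= x <= 1 -> quadratic_surd x ->
        rational (question_mark t x)].
Proof.
split.
- split; last exact: question_mark_homeomorphism.
  by move=> x y; rewrite !in_itv /= => /andP[x0 _] /andP[_ y1] xy; exact: question_mark_lt.
- exact: question_mark_singular.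
- by move=> x; rewrite in_itv; exact: question_mark_semiconj.
- by move=> tQ x; exact: rational_question_mark_surd.
Qed.
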